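(* Let $(a,b)\in\mathbb{R}^2$, let $M,N\subsetneq\mathbb{R}$ be neutrices and let $V\subseteq\mathbb{R}^2$ be an $(M,N)$-neighborhood of $(a,b)$. Let $g:V\to\mathbb{R}$ be an internal differentiable function such that $g(a,b)=0$, and consider the equation $g(x,y)=0$ for $(x,y)\in V$. Put $$\gamma_x=\lim_{(x,y)\twoheadrightarrow(a+M,b+N)}\frac{\partial g}{\partial x}(x,y),\qquad \gamma_y=\lim_{(x,y)\twoheadrightarrow(a+M,b+N)}\frac{\partial g}{\partial y}(x,y)$$ (inner limits, assumed well-defined). Assume that the $N$-partial derivative $\frac{\partial g}{\partial_N y}(a,b)$ is well-defined and zeroless and that $A=\mathrm{N}\left(\frac{\partial g}{\partial_N y}(a,b)\right)$ is such that (a) $N$ is stable for $A$, i.e. $N$ contains all absorbers of $A$; (b) $g$ and $\frac{\partial g}{\partial y}$ are $(M,N)\times A$-inner continuous on $V$; (c) $\gamma_y$ is zeroless. Then there exist a real $\delta>M$ and a unique $M$-differentiable function $f:U=[a-\delta,a+\delta]\to\mathbb{R}$ such that $g(x,f(x))=0$ for all $x\in U$, $f(a)=b$, and $$D_Mf(a)\subseteq-\frac{\gamma_x}{\gamma_y}.$$ In addition, if $\gamma_x$ is zeroless and $(\gamma_x/\gamma_y)M\subseteq N$, the function $f$ is $M\times N$-inner continuous at $a$.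
   Context: Setting: Nelson's Internal Set Theory IST, together with external sets (in the sense of Kanovei and Reeken). External numbers. A (scalar) neutrix is a (possibly external) convex additive subgroup of $\mathbb{R}$; by convention all neutrices are different from $\mathbb{R}$. An external number is a set $\alpha=a+A=\{a+x: x\in A\}$ with $a\in\mathbb{R}$ and $A$ a neutrix; $\mathrm{N}(\alpha)=A$ is its neutrix part. $\mathbb{E}$ is the class of external numbers; real numbers ($A=\{0\}$) and neutrices are external numbers. $\alpha$ is zeroless if $0\notin\alpha$. For $\alpha=a+A,\beta=b+B$: $\alpha\pm\beta=a\pm b+\max\{A,B\}$ (max for inclusion), $\alpha\beta=ab+\max\{aB,bA,AB\}$, and, if $\alpha$ is zeroless, $1/\alpha=1/a+A/a^2$, $\beta/\alpha=\beta\cdot(1/\alpha)$. $|\alpha|=|a|+A$. $\alpha<\beta$ (equivalently $\beta>\alpha$) iff $s<t$ for all $s\in\alpha,t\in\beta$; in particular, for real $r$ and a neutrix $M$, $r>M$ means that $r$ exceeds all elements of $M$. An absorber of a neutrix $A$ is a real $r$ with $rA\subsetneq A$. Neighborhoods. An $(M,N)$-neighborhood of $(a,b)$ is an internal set $V\subseteq\mathbb{R}^2$ containing $(a-r_1,a+r_1)\times(b-r_2,b+r_2)$ for some reals $r_1>M$, $r_2>N$. Limits. Let $H$ be a function with values in $\mathbb{E}$ (real-valued functions being a special case) and domain $X$, $K$ a neutrix. - One variable, outer: $\alpha\in\mathbb{E}$ satisfies $K\text{-}\lim_{x\to a+M}H(x)=\alpha$ if for every real $\varepsilon>K$ there is $\delta>M$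 such that $|H(x)-\alpha|<\varepsilon$ for all $x\in X$ with $M<|x-a|<\delta$. - One variable, inner: $K\text{-}\lim_{x\twoheadrightarrow a+M}H(x)=\alpha$ is defined in the same way with the condition $0<|x-a|<\delta$. - Two variables, inner: $K\text{-}\lim_{(x,y)\twoheadrightarrow(a+M,b+N)}H(x,y)=\alpha$ if for every real $\varepsilon>K$ there are $\delta_1>M,\delta_2>N$ such that $|H(x,y)-\alpha|<\varepsilon$ for all $(x,y)\in X$ with $0<|x-a|<\delta_1$, $0<|y-b|<\delta_2$. In each case the corresponding limit without prefix $K$ is the intersection of all $\alpha\in\mathbb{E}$ such that $\alpha$ is the corresponding $\mathrm{N}(\alpha)$-limit; it is well-defined (exists) if there is at least one such $\alpha$, and it is then an external number. Inner continuity. A one-variable function $f$ is $M\times N$-inner continuous at $a$ if $N\text{-}\lim_{x\twoheadrightarrow a+M}f(x)=f(a)+N$. A two-variable function $H$ is $(M,N)\times A$-inner continuous at $(c,d)$ if $A\text{-}\lim_{(x,y)\twoheadrightarrow(c+M,d+N)}H(x,y)=H(c,d)+A$, and on $V$ if this holds at every point of $V$. Derivatives. $\frac{\partial g}{\partial x},\frac{\partial g}{\partial y}$ are ordinary partial derivatives. $\frac{\partial g}{\partial_N y}(a,b)=\lim_{y\to b+N}\frac{g(a,y)-g(a,b)}{y-b}$ (outer limit). For $c\in U$, $D_Mf(c)=\lim_{x\to c+M}\frac{f(x)-f(c)}{x-c}$ (outer limit, $x$ ranging over $U$); $f$ is $M$-differentiable at $c$ if this limit exists, and $f:U\to\mathbb{R}$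 is an $M$-differentiable function if it is $M$-differentiable at the points of $U$.
   Formalization: Uniqueness of f is claimed only among M-differentiable solutions with values in a box [b-η,b+η], η>N, U×[b-η,b+η]⊆V (the unrestricted claim fails for g=y(y-1), M=N=infinitesimals); the reals of IST are modelled by an arbitrary ultrapower. *)

(* Defs.v *)
From HB Require Import structures.
From mathcomp Require Import all_boot all_order all_algebra.
From mathcomp Require Import all_classical all_reals all_analysis.

Set Implicit Arguments.
Unset Strict Implicit.
Unset Printing Implicit Defensive.

Import Order.TTheory GRing.Theory Num.Theory.
Import numFieldNormedType.Exports.

Local Open Scope classical_set_scope.
Local Open Scope ring_scope.
Local Open Scope quotient_scope.

(* The reals of Internal Set Theory are modelled by an ultrapower [hyper UF] of
   a [realType], for an arbitrary index type and an arbitrary ultrafilter.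
   Internal sets and functions are those induced by a family indexed by [I];
   an external set is an arbitrary [set (hyper UF)].  Unqualified notions of
   analysis (differentiability, partial derivatives) are the ordinary
   epsilon-delta notions over the ordered field [hyper UF], with epsilon and
   delta ranging over all of its positive elements. *)
Section Ultrapower.
Context {R : realType} {I : Type} {F : set_system I}.

Definition ueqv (x y : I -> R) : bool := `[< F [set i | x i = y i] >].

Context (UF : UltraFilter F).

Lemma ueqv_refl : reflexive ueqv.
Proof. by move=> x; apply/asboolP; apply: filterS filterT => i. Qed.

Lemma ueqv_sym : symmetric ueqv.
Proof.
by move=> x y; apply: asbool_equiv_eq; split; apply: filterS => i /= ->.
Qed.

Lemma ueqv_trans : transitive ueqv.
Proof.
move=> y x z /asboolP xy /asboolP yz; apply/asboolP.
by apply: filterS2 xy yz => i /= -> ->.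
Qed.

Canonical ueqv_equiv := EquivRel ueqv ueqv_refl ueqv_sym ueqv_trans.

Definition hyper := {eq_quot ueqv_equiv}.

HB.instance Definition _ := Choice.on hyper.
HB.instance Definition _ := EqQuotient.on hyper.

Definition hcls (x : I -> R) : hyper := \pi_hyper x.

Lemma hclsP (x y : I -> R) : hcls x = hcls y <-> F [set i | x i = y i].
Proof.
split; first by move/eqP; rewrite /hcls eqmodE => /asboolP.
by move=> h; apply/eqP; rewrite /hcls eqmodE; apply/asboolP.
Qed.

Lemma hreprK (x : hyper) : hcls (repr x) = x.
Proof. exact: reprK. Qed.

Lemma repr_hcls (x : I -> R) : F [set i | repr (hcls x) i = x i].
Proof. by apply/hclsP; rewrite hreprK. Qed.

Definition hopp (x : hyper) := hcls (fun i => - repr x i).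
Definition hinv (x : hyper) := hcls (fun i => (repr x i)^-1).
Definition hnorm (x : hyper) := hcls (fun i => `|repr x i|).
Definition hadd (x y : hyper) := hcls (fun i => repr x i + repr y i).
Definition hmul (x y : hyper) := hcls (fun i => repr x i * repr y i).
Definition hle (x y : hyper) : bool := `[< F [set i | repr x i <= repr y i] >].
Definition hlt (x y : hyper) : bool := (y != x) && hle x y.

Lemma haddE x y : hadd (hcls x) (hcls y) = hcls (fun i => x i + y i).
Proof. by apply/hclsP; apply: filterS2 (repr_hcls x) (repr_hcls y) => i /= -> ->. Qed.

Lemma hmulE x y : hmul (hcls x) (hcls y) = hcls (fun i => x i * y i).
Proof. by apply/hclsP; apply: filterS2 (repr_hcls x) (repr_hcls y) => i /= -> ->. Qed.

Lemma hoppE x : hopp (hcls x) = hcls (fun i => - x i).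
Proof. by apply/hclsP; apply: filterS (repr_hcls x) => i /= ->. Qed.

Lemma hinvE x : hinv (hcls x) = hcls (fun i => (x i)^-1).
Proof. by apply/hclsP; apply: filterS (repr_hcls x) => i /= ->. Qed.

Lemma hnormE x : hnorm (hcls x) = hcls (fun i => `|x i|).
Proof. by apply/hclsP; apply: filterS (repr_hcls x) => i /= ->. Qed.

Lemma hleP x y : reflect (F [set i | x i <= y i]) (hle (hcls x) (hcls y)).
Proof.
rewrite /hle; apply: (iffP (asboolP _)) => h.
  by apply: filterS3 h (repr_hcls x) (repr_hcls y) => i /= + <- <-.
by apply: filterS3 h (repr_hcls x) (repr_hcls y) => i /= + -> ->.
Qed.

Lemma hyper_ind (P : hyper -> Prop) : (forall x, P (hcls x)) -> forall x, P x.
Proof. by move=> h x; rewrite -[x]hreprK. Qed.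

Lemma hclsW (x y : I -> R) : (forall i, x i = y i) -> hcls x = hcls y.
Proof. by move=> h; apply/hclsP; apply: filterS filterT => i _ /=. Qed.

Lemma haddA : associative hadd.
Proof.
elim/hyper_ind=> x; elim/hyper_ind=> y; elim/hyper_ind=> z.
by rewrite !haddE; apply: hclsW => i; rewrite addrA.
Qed.

Lemma haddC : commutative hadd.
Proof.
elim/hyper_ind=> x; elim/hyper_ind=> y.
by rewrite !haddE; apply: hclsW => i; rewrite addrC.
Qed.

Lemma hadd0 : left_id (hcls (fun=> 0)) hadd.
Proof. by elim/hyper_ind=> x; rewrite haddE; apply: hclsW => i; rewrite add0r. Qed.

Lemma haddN : left_inverse (hcls (fun=> 0)) hopp hadd.
Proof.
by elim/hyper_ind=> x; rewrite hoppE haddE; apply: hclsW => i; rewrite addNr.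
Qed.

HB.instance Definition _ := GRing.isZmodule.Build hyper haddA haddC hadd0 haddN.

Lemma hmulA : associative hmul.
Proof.
elim/hyper_ind=> x; elim/hyper_ind=> y; elim/hyper_ind=> z.
by rewrite !hmulE; apply: hclsW => i; rewrite mulrA.
Qed.

Lemma hmulC : commutative hmul.
Proof.
elim/hyper_ind=> x; elim/hyper_ind=> y.
by rewrite !hmulE; apply: hclsW => i; rewrite mulrC.
Qed.

Lemma hmul1 : left_id (hcls (fun=> 1)) hmul.
Proof. by elim/hyper_ind=> x; rewrite hmulE; apply: hclsW => i; rewrite mul1r. Qed.

Lemma hmulD : left_distributive hmul hadd.
Proof.
elim/hyper_ind=> x; elim/hyper_ind=> y; elim/hyper_ind=> z.
by rewrite !(hmulE, haddE); apply: hclsW => i; rewrite mulrDl.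
Qed.

Lemma hone_neq0 : hcls (fun=> 1) != 0.
Proof.
apply/eqP => /hclsP h.
by have [i /= /eqP] := filter_ex h; rewrite oner_eq0.
Qed.

HB.instance Definition _ :=
  GRing.Zmodule_isComNzRing.Build hyper hmulA hmulC hmul1 hmulD hone_neq0.

Lemma hmulVx (x : hyper) : x != 0 -> hinv x * x = 1.
Proof.
elim/hyper_ind: x => x x0; rewrite hinvE [_ * _]hmulE; apply/hclsP.
have [h|] := in_ultra_setVsetC [set i | x i = 0] UF.
  by move/eqP: x0; case; apply/hclsP.
by apply: filterS => i /= /eqP xi0; rewrite mulVf.
Qed.

Lemma hinv0 : hinv 0 = 0.
Proof. by rewrite [LHS]hinvE; apply: hclsW => i; rewrite invr0. Qed.

HB.instance Definition _ := GRing.ComNzRing_isField.Build hyper hmulVx hinv0.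

Lemma hle0_add x y : hle 0 x -> hle 0 y -> hle 0 (x + y).
Proof.
elim/hyper_ind: x => x; elim/hyper_ind: y => y /hleP x0 /hleP y0.
by rewrite [_ + _]haddE; apply/hleP; apply: filterS2 x0 y0 => i; exact: addr_ge0.
Qed.

Lemma hle0_mul x y : hle 0 x -> hle 0 y -> hle 0 (x * y).
Proof.
elim/hyper_ind: x => x; elim/hyper_ind: y => y /hleP x0 /hleP y0.
by rewrite [_ * _]hmulE; apply/hleP; apply: filterS2 x0 y0 => i; exact: mulr_ge0.
Qed.

Lemma hle0_anti x : hle 0 x -> hle x 0 -> x = 0.
Proof.
elim/hyper_ind: x => x /hleP x0 /hleP y0; apply/hclsP.
by apply: filterS2 x0 y0 => i /= h1 h2; apply/le_anti; rewrite h1 h2.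
Qed.

Lemma hsub_ge0 x y : hle 0 (y - x) = hle x y.
Proof.
elim/hyper_ind: x => x; elim/hyper_ind: y => y.
rewrite [- _]hoppE [_ + _]haddE.
by apply/hleP/hleP; apply: filterS => i /=; rewrite subr_ge0.
Qed.

Lemma hle0_total x : hle 0 x || hle x 0.
Proof.
elim/hyper_ind: x => x.
have [h|h] := in_ultra_setVsetC [set i | 0 <= x i] UF.
  by apply/orP; left; apply/hleP.
apply/orP; right; apply/hleP; apply: filterS h => i /= /negP.
by rewrite -ltNge => /ltW.
Qed.

Lemma hnormN x : hnorm (- x) = hnorm x.
Proof.
elim/hyper_ind: x => x; rewrite [- _]hoppE !hnormE.
by apply: hclsW => i; rewrite normrN.
Qed.

Lemma hge0_norm x : hle 0 x -> hnorm x = x.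
Proof.
elim/hyper_ind: x => x /hleP x0; rewrite hnormE; apply/hclsP.
by apply: filterS x0 => i /=; exact: ger0_norm.
Qed.

HB.instance Definition _ := Num.IntegralDomain_isLeReal.Build hyper
  hle0_add hle0_mul hle0_anti hsub_ge0 hle0_total hnormN hge0_norm
  (fun _ _ => erefl).

Definition internal_set2 (V : set (hyper * hyper)) : Prop :=
  exists W : I -> set (R * R),
    forall p, V p <-> F [set i | W i (repr p.1 i, repr p.2 i)].

Definition internal_fun1 (U : set hyper) (f : hyper -> hyper) : Prop :=
  exists G : I -> R -> R,
    forall x, U x -> f x = hcls (fun i => G i (repr x i)).

Definition internal_fun2 (V : set (hyper * hyper))
    (g : hyper * hyper -> hyper) : Prop :=
  exists G : I -> R * R -> R,
    forall p, V p -> g p = hcls (fun i => G i (repr p.1 i, repr p.2 i)).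

End Ultrapower.

Arguments hyper R {I F} UF.

Section ExternalNumbers.
Context {S : realFieldType}.

Record neutrix := Neutrix {
  nset :> set S;
  neutrix_itv : is_interval nset;
  neutrix0 : nset 0;
  neutrixB : forall x y, nset x -> nset y -> nset (x - y);
  neutrix_proper : nset <> setT }.

(* The external number [rep + npart]; the representative is not unique, so
   external numbers are to be compared through the coercion [ext_set]. *)
Record extnum := ExtNum { rep : S ; npart : neutrix }.

Definition ext_set (al : extnum) : set S :=
  [set rep al + x | x in npart al].
Coercion ext_set : extnum >-> set.

Lemma neutrixN (A : neutrix) x : nset A x -> nset A (- x).
Proof. by move=> Ax; rewrite -sub0r; apply: neutrixB Ax; exact: neutrix0. Qed.

Lemma neutrixD (A : neutrix) x y : nset A x -> nset A y -> nset A (x + y).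
Proof.
by move=> Ax Ay; rewrite -[y]opprK; apply: neutrixB Ax _; exact: neutrixN.
Qed.

Lemma neutrix_norm (A : neutrix) x : nset A x -> nset A `|x|.
Proof. by move=> Ax; case: (ler0P x) => // _; exact: neutrixN. Qed.

Lemma neutrix_le (A : neutrix) x y : nset A x -> `|y| <= `|x| -> nset A y.
Proof.
move=> /neutrix_norm Ax yx; apply: (neutrix_itv (neutrixN Ax) Ax).
by rewrite -ler_norml.
Qed.

Lemma neutrix_notin (A : neutrix) : exists r, ~ nset A r.
Proof.
apply: contrapT => h; apply: (@neutrix_proper A).
by apply/seteqP; split=> // x _; apply: contrapT => nx; apply: h; exists x.
Qed.

Lemma neutrix_of_le (A : set S) : A 0 ->
  (forall x y, A x -> A y -> exists2 z, A z & `|x| + `|y| <= `|z|) ->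
  (forall x y, A x -> `|y| <= `|x| -> A y) ->
  is_interval A /\ forall x y, A x -> A y -> A (x - y).
Proof.
move=> A0 AD Ale; split=> x y Ax Ay.
  move=> z /andP[xz zy]; have [t At tE] := AD _ _ Ax Ay; apply: (Ale _ _ At).
  apply: le_trans tE; rewrite ler_norml; apply/andP; split.
    apply: le_trans xz; rewrite lerNl.
    by apply: (le_trans (ler_norm _)); rewrite normrN lerDl.
  by apply: (le_trans zy); apply: (le_trans (ler_norm _)); rewrite lerDr.
have [t At tE] := AD _ _ Ax Ay; apply: (Ale _ _ At).
by apply: le_trans tE; exact: ler_normB.
Qed.

Lemma neutrix_double (A : neutrix) x y : nset A x -> nset A y ->
  exists2 z, nset A z & `|x| + `|y| <= `|z|.
Proof.
move=> Ax Ay; exists (`|x| + `|y|); last by rewrite [leRHS]ger0_norm ?addr_ge0.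
by apply: neutrixD; exact: neutrix_norm.
Qed.

Lemma zero_neutrix_subproof :
  (is_interval [set (0 : S)] /\
   forall x y : S, [set 0] x -> [set 0] y -> [set 0] (x - y)) /\
  [set (0 : S)] <> setT.
Proof.
split; last first.
  by move=> /seteqP[_ /(_ 1 Logic.I)] /= /eqP; rewrite oner_eq0.
split=> [x y -> -> z|x y -> ->]; last by rewrite /= subr0.
by move=> h; apply/esym/le_anti.
Qed.

Definition zero_neutrix : neutrix :=
  Neutrix zero_neutrix_subproof.1.1 erefl zero_neutrix_subproof.1.2
    zero_neutrix_subproof.2.

Definition scale_set (a : S) (A : set S) : set S := [set a * x | x in A].

Lemma scale_neutrix_subproof (a : S) (A : neutrix) :
  [/\ is_interval (scale_set a A), scale_set a A 0,
      forall x y, scale_set a A x -> scale_set a A y -> scale_set a A (x - y) &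
      scale_set a A <> setT].
Proof.
have S0 : scale_set a A 0 by exists 0; [exact: neutrix0|rewrite mulr0].
have [|x y|Si SB] := neutrix_of_le S0.
- move=> _ _ [x Ax <-] [y Ay <-].
  have [z Az zE] := neutrix_double Ax Ay; exists (a * z); first by exists z.
  by rewrite !normrM -mulrDr ler_wpM2l.
- case=> z Az <-; have [->|a0] := eqVneq a 0.
    by rewrite mul0r normr0 normr_le0 => /eqP ->; exists 0; [exact: neutrix0|rewrite mul0r].
  move=> yz; exists (y / a); last by rewrite mulrC divfK.
  apply: neutrix_le Az _; rewrite normrM normfV ler_pdivrMr ?normr_gt0//.
  by rewrite mulrC -normrM.
split=> // /seteqP[_ h]; have [a0|a0] := eqVneq a 0.
  have [x _] := h 1 Logic.I; rewrite a0 mul0r => /esym/eqP.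
  by rewrite oner_eq0.
have [r nr] := neutrix_notin A; apply: nr.
by have [x Ax /(mulfI a0) <-] := h (a * r) Logic.I.
Qed.

Definition scale_neutrix (a : S) (A : neutrix) : neutrix :=
  let: And4 Si S0 SB ST := scale_neutrix_subproof a A in Neutrix Si S0 SB ST.

Definition mul_set (A B : set S) : set S := [set x * y | x in A & y in B].

Lemma mul_neutrix_subproof (A B : neutrix) :
  [/\ is_interval (mul_set A B), mul_set A B 0,
      forall x y, mul_set A B x -> mul_set A B y -> mul_set A B (x - y) &
      mul_set A B <> setT].
Proof.
have P0 : mul_set A B 0.
  by exists 0; [exact: neutrix0|exists 0; [exact: neutrix0|rewrite mulr0]].
have [|x y|Pi PB] := neutrix_of_le P0.
- move=> _ _ [x Ax [y By <-]] [x' Ax' [y' By' <-]].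
  have [z Az zE] := neutrix_double Ax Ax'; have [t Bt tE] := neutrix_double By By'.
  exists (z * t); first by exists z => //; exists t.
  rewrite !normrM; apply: le_trans (ler_pM _ _ zE tE); rewrite ?addr_ge0//.
  rewrite mulrDl !mulrDr lerD//; first by rewrite lerDl mulr_ge0.
  by rewrite lerDr mulr_ge0.
- case=> u Au [v Bv <-]; have [->|v0] := eqVneq v 0.
    by rewrite mulr0 normr0 normr_le0 => /eqP ->.
  move=> yz; exists (y / v); last by exists v => //; rewrite divfK.
  by apply: neutrix_le Au _; rewrite normrM normfV ler_pdivrMr ?normr_gt0// -normrM.
split=> // /seteqP[_ h].
have [r nr] := neutrix_notin A; have [s ns] := neutrix_notin B.
have [x Ax [y By xyE]] := h (r * s) Logic.I.
have xr : `|x| < `|r|.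
  by rewrite ltNge; apply/negP => rx; apply: nr; exact: neutrix_le rx.
have ys : `|y| < `|s|.
  by rewrite ltNge; apply/negP => rx; apply: ns; exact: neutrix_le rx.
by have := ltr_pM (normr_ge0 _) (normr_ge0 _) xr ys; rewrite -!normrM xyE ltxx.
Qed.

Definition mul_neutrix (A B : neutrix) : neutrix :=
  let: And4 Pi P0 PB PT := mul_neutrix_subproof A B in Neutrix Pi P0 PB PT.

Definition max_neutrix (A B : neutrix) : neutrix :=
  if `[< A `<=` B >] then B else A.

Definition ext_real (a : S) : extnum := ExtNum a zero_neutrix.
Definition ext_neutrix (A : neutrix) : extnum := ExtNum 0 A.

Definition ext_opp (al : extnum) : extnum := ExtNum (- rep al) (npart al).

Definition ext_add (al be : extnum) : extnum :=
  ExtNum (rep al + rep be) (max_neutrix (npart al) (npart be)).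

Definition ext_sub (al be : extnum) : extnum :=
  ExtNum (rep al - rep be) (max_neutrix (npart al) (npart be)).

Definition ext_mul (al be : extnum) : extnum :=
  ExtNum (rep al * rep be)
    (max_neutrix (scale_neutrix (rep al) (npart be))
      (max_neutrix (scale_neutrix (rep be) (npart al))
        (mul_neutrix (npart al) (npart be)))).

(* Meaningful for zeroless [al] only. *)
Definition ext_inv (al : extnum) : extnum :=
  ExtNum (rep al)^-1 (scale_neutrix (rep al ^+ 2)^-1 (npart al)).

Definition ext_div (be al : extnum) : extnum := ext_mul be (ext_inv al).

Definition ext_abs (al : extnum) : extnum := ExtNum `|rep al| (npart al).

Definition zeroless (al : extnum) : Prop := ~ ext_set al 0.

(* A real [r] enters this order as the singleton [[set r]]. *)
Definition ext_lt (A B : set S) : Prop := forall s t, A s -> B t -> s < t.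

Definition absorber (A : neutrix) (r : S) : Prop := scale_set r A `<` A.

Definition stable_for (N A : neutrix) : Prop := absorber A `<=` N.

Definition outer_lim (K : neutrix) (X : set S) (H : S -> extnum)
    (a : S) (M : neutrix) (al : extnum) : Prop :=
  forall e : S, ext_lt K [set e] ->
  exists2 d : S, ext_lt M [set d] &
    forall x, X x -> ext_lt M [set `|x - a|] -> `|x - a| < d ->
      ext_lt (ext_abs (ext_sub (H x) al)) [set e].

Definition inner_lim (K : neutrix) (X : set S) (H : S -> extnum)
    (a : S) (M : neutrix) (al : extnum) : Prop :=
  forall e : S, ext_lt K [set e] ->
  exists2 d : S, ext_lt M [set d] &
    forall x, X x -> 0 < `|x - a| < d ->
      ext_lt (ext_abs (ext_sub (H x) al)) [set e].

Definition inner_lim2 (K : neutrix) (X : set (S * S)) (H : S * S -> extnum)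
    (c : S * S) (M N : neutrix) (al : extnum) : Prop :=
  forall e : S, ext_lt K [set e] ->
  exists d1 d2 : S, [/\ ext_lt M [set d1], ext_lt N [set d2] &
    forall p, X p -> 0 < `|p.1 - c.1| < d1 -> 0 < `|p.2 - c.2| < d2 ->
      ext_lt (ext_abs (ext_sub (H p) al)) [set e]].

(* Limits without prefix: [L al] is to be read "[al] is the [npart al]-limit".
   The intersection [lim_set L] of all such [al] is an external number in the
   intended universe of external sets, where every cut of the reals is a
   translate of a neutrix; for arbitrary subsets of an ultrapower it could be
   empty, so [is_ext_lim L ga] states that it is the external number [ga]. *)
Definition lim_exists (L : extnum -> Prop) : Prop := exists al, L al.

Definition lim_set (L : extnum -> Prop) : set S :=
  [set s | forall al, L al -> ext_set al s].

Definition is_ext_lim (L : extnum -> Prop) (ga : extnum) : Prop :=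
  lim_exists L /\ ext_set ga = lim_set L.

Definition outer_limit (X : set S) (H : S -> extnum) (a : S) (M : neutrix) :=
  fun al => outer_lim (npart al) X H a M al.

Definition inner_limit2 (X : set (S * S)) (H : S * S -> extnum) (c : S * S)
    (M N : neutrix) :=
  fun al => inner_lim2 (npart al) X H c M N al.

Definition inner_continuous (M N : neutrix) (X : set S) (H : S -> extnum)
    (a : S) : Prop :=
  inner_lim N X H a M (ext_add (H a) (ext_neutrix N)).

Definition inner_continuous2 (M N A : neutrix) (X : set (S * S))
    (H : S * S -> extnum) (c : S * S) : Prop :=
  inner_lim2 A X H c M N (ext_add (H c) (ext_neutrix A)).

Definition diff_quot (f : S -> S) (c : S) : S -> extnum :=
  fun x => ext_real ((f x - f c) / (x - c)).

Definition D_limit (M : neutrix) (U : set S) (f : S -> S) (c : S) :=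
  outer_limit U (diff_quot f c) c M.

Definition M_differentiable (M : neutrix) (U : set S) (f : S -> S) : Prop :=
  forall c, U c -> lim_exists (D_limit M U f c).

Definition D_set (M : neutrix) (U : set S) (f : S -> S) (c : S) : set S :=
  lim_set (D_limit M U f c).

Definition partial_x (g : S * S -> S) (p : S * S) : S :=
  derive1 (fun x => g (x, p.2)) p.1.

Definition partial_y (g : S * S -> S) (p : S * S) : S :=
  derive1 (fun y => g (p.1, y)) p.2.

Definition partial_N_y (N : neutrix) (V : set (S * S)) (g : S * S -> S)
    (p : S * S) :=
  outer_limit [set y | V (p.1, y)] (diff_quot (fun y => g (p.1, y)) p.2) p.2 N.

(* A function on [V] is represented by a total function whose values outside
   [V] are arbitrary; at a non-interior point of [V], [differentiable] means
   that the chosen extension is differentiable there, so that the partial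
   derivatives make sense at every point of [V]. *)
Definition differentiable_on (V : set (S * S)) (g : S * S -> S) : Prop :=
  forall p, V p -> differentiable g p.

End ExternalNumbers.

Arguments neutrix S : clear implicits.
Arguments extnum S : clear implicits.

Definition MN_neighborhood {R : realType} {I : Type} {F : set_system I}
    {UF : UltraFilter F} (M N : neutrix (hyper R UF))
    (c : hyper R UF * hyper R UF) (V : set (hyper R UF * hyper R UF)) : Prop :=
  internal_set2 V /\
  exists r1 r2, [/\ ext_lt M [set r1], ext_lt N [set r2] &
    `]c.1 - r1, c.1 + r1[ `*` `]c.2 - r2, c.2 + r2[ `<=` V].

(* Restricting the values to [Y] is needed for uniqueness: if [M] is not [0],
   [M]-differentiability does not prevent a function from jumping, at a single
   point at distance more than [M] from [a], to another zero of [g (x, _)]. *)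
Definition implicit_solution {S : realFieldType} (M : neutrix S)
    (g : S * S -> S) (a b : S) (U Y : set S) (f : S -> S) : Prop :=
  [/\ M_differentiable M U f,
      forall x, U x -> Y (f x),
      forall x, U x -> g (x, f x) = 0 &
      f a = b].

(* Main.v *)
Require Import Defs.
From mathcomp Require Import all_boot all_order all_algebra.
From mathcomp Require Import all_classical all_reals all_analysis.
From mathcomp Require Import ring lra.
Import Order.TTheory GRing.Theory Num.Theory.
Import numFieldNormedType.Exports.
Local Open Scope classical_set_scope.
Local Open Scope ring_scope.

(** The statement combines a standard argument inside the ultrapower with an
    estimate of sizes relative to neutrices.

    Inside the ultrapower, internal functions obey the mean value inequality
    and the intermediate value property, because an internal bounded set has a
    least upper bound ([sublevel_supP]), which is all that the usual proofs
    require ([sublevel_sup_root], [mean_value_le]).  The limit [gamma_y], being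
    an intersection of limits, is itself a limit ([is_ext_lim_attained]), so
    with [cy] a representative of it and [e > N(gamma_y)], the partial
    derivative in [y] is within [e] of [cy] on a punctured box.  Integrated, this
    says that the difference quotients of [g] in [y] are within [e] of [cy] on
    the whole box, the cross included ([punctured_box_quotient]); likewise for
    [x].  As [gamma_y] is zeroless, [e = |cy| / 2] is allowed, hence [g (x, _)]
    is strictly monotone with slope at least [|cy| / 2].

    To find a zero of [g (x, _)] in [[b - eta, b + eta]] it remains to have
    [|g (x, b)| <= |cy| eta / 4] for all [x] with [|x - a| < delta], for some
    [delta > M].  The [A]-continuity of [g] at [(a, b)], where
    [A = N(beta)], gives this as soon as [|cy| eta > A].  Now [cy] is
    comparable with the zeroless [beta], so [cy] is not in [A], and by stability
    [eta > N] is no absorber of [A], i.e. [A] is contained in [eta A]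
    ([small_on_axis]).  The same estimate for arbitrarily small [eta > N]
    shows that [f] is [M]x[N]-inner continuous at [a].

    For zeros [(x, y)] and [(x', y')] of [g], the quotient estimates yield the
    approximate relation [cx (x - x') + cy (y - y') = 0]
    ([zeros_linear_relation]).  It makes [f] Lipschitz, whence
    [M]-differentiability: for [M = 0] it is ordinary differentiability, and for
    other [M] bounded difference quotients suffice ([lipschitz_D_limit]).  At
    [a], with errors just above the neutrices of [gamma_x] and [gamma_y], it
    shows that [- gamma_x / gamma_y] is an [M]-limit of the difference quotients
    ([implicit_D_limit]), so that it contains their limit. *)

Set Implicit Arguments.
Unset Strict Implicit.
Unset Printing Implicit Defensive.

Local Notation above A r := (ext_lt (nset A) [set r]).

(** * Neutrices and external numbers *)

Section Neutrices.
Context {S : realFieldType}.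
Implicit Types (A B K M N : neutrix S) (al ga : extnum S) (r s e : S).

Lemma aboveP A r : above A r <-> 0 < r /\ ~ nset A r.
Proof.
split=> [h|[r0 nAr] s _ As ->].
  split; first exact: h (neutrix0 A) erefl.
  by move=> Ar; have := h _ _ Ar erefl; rewrite ltxx.
rewrite ltNge; apply/negP => rs; apply: nAr; apply: neutrix_le As _.
by rewrite !ger0_norm// ?ltW// (lt_le_trans r0).
Qed.

Lemma above_gt0 A r : above A r -> 0 < r.
Proof. by case/aboveP. Qed.

Lemma above_norm A r : ~ nset A r -> above A `|r|.
Proof.
move=> nAr; apply/aboveP; split.
  by rewrite normr_gt0; apply/eqP => r0; apply: nAr; rewrite r0; exact: neutrix0.
by move=> /neutrix_le h; apply/nAr/h; rewrite normr_id.
Qed.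

Lemma above_sub A B r : nset A `<=` nset B -> above B r -> above A r.
Proof. by move=> AB h x _ /AB Bx ->; exact: h. Qed.

Lemma above_min A r s : above A r -> above A s -> above A (Num.min r s).
Proof. by move=> Ar As; rewrite minEle; case: ifP. Qed.

Lemma neutrixMn A x n : nset A x -> nset A (x *+ n).
Proof.
move=> Ax; elim: n => [|n IH]; first by rewrite mulr0n; exact: neutrix0.
by rewrite mulrS; exact: neutrixD.
Qed.

Lemma above_div n A r : above A r -> above A (r / n.+1%:R).
Proof.
move=> /aboveP[r0 nAr]; apply/aboveP; split; first by rewrite divr_gt0.
by move=> /(neutrixMn n.+1); rewrite -[X in nset A X]mulr_natr divfK ?pnatr_eq0.
Qed.

Lemma exists_above A : exists r, above A r.
Proof. by have [r /above_norm] := neutrix_notin A; exists `|r|. Qed.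

Lemma max_zero_neutrix A : max_neutrix (zero_neutrix (S := S)) A = A.
Proof.
by rewrite /max_neutrix asboolT// => x ->; exact: neutrix0.
Qed.

(** Two neutrices are comparable because both are symmetric and convex. *)
Lemma max_neutrixS A B :
  nset A `<=` nset (max_neutrix A B) /\ nset B `<=` nset (max_neutrix A B).
Proof.
rewrite /max_neutrix; case: asboolP => [//|nAB]; split=> // b Bb.
apply: contrapT => nAb; apply: nAB => a Aa; apply: neutrix_le Bb _.
rewrite leNgt; apply/negP => ba; apply: nAb.
by apply: neutrix_le Aa (ltW ba).
Qed.

Lemma scale_neutrixE r A : nset (scale_neutrix r A) = scale_set r A.
Proof. by rewrite /scale_neutrix; case: scale_neutrix_subproof. Qed.

Lemma above_scale r s A : r != 0 -> above (scale_neutrix r A) s ->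
  above A (s / `|r|).
Proof.
move=> r0 /aboveP[s0]; rewrite scale_neutrixE => nAs.
apply/aboveP; split; first by rewrite divr_gt0// normr_gt0.
move=> As; apply: nAs; exists (s / r); last by rewrite mulrC divfK.
by apply: neutrix_le As _; rewrite !normrM !normfV normr_id.
Qed.

Lemma ext_setP al s : ext_set al s <-> nset (npart al) (s - rep al).
Proof.
split=> [[x Ax <-]|As]; first by rewrite addrAC subrr add0r.
by exists (s - rep al); rewrite // addrC subrK.
Qed.

Lemma zeroless_rep al : zeroless al <-> ~ nset (npart al) (rep al).
Proof.
rewrite /zeroless ext_setP sub0r; split=> h; contradict h.
  exact: neutrixN.
by rewrite -[rep al]opprK; exact: neutrixN.
Qed.

(** If [r] is above [N], it is no absorber of [A], and comparability leaves
    only the inclusion of [A] in [r A]. *)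
Lemma stable_for_sub N A r : stable_for N A -> above N r ->
  nset A `<=` scale_set r A.
Proof.
move=> st /aboveP[r0 nNr] x Ax; apply: contrapT => nx; apply: nNr; apply: st.
have small y : scale_set r A y -> `|y| < `|x|.
  case=> z Az <-; rewrite ltNge; apply/negP => xz; apply: nx.
  exists (x / r); last by rewrite mulrC divfK// gt_eqF.
  apply: neutrix_le Az _.
  by rewrite normrM normfV ler_pdivrMr ?normr_gt0 ?gt_eqF// mulrC -normrM.
split=> [y /small /ltW|]; first exact: neutrix_le.
by move=> /(_ _ Ax).
Qed.

Lemma stable_for_above N A r c : stable_for N A -> above N r ->
  ~ nset A c -> above A (`|c| * r).
Proof.
move=> st Nr nAc; have r0 := above_gt0 Nr.
have c0 := above_gt0 (above_norm nAc).
apply/aboveP; split; first by rewrite mulr_gt0.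
move=> /(stable_for_sub st Nr)[z Az].
rewrite mulrC => /(mulIf (lt0r_neq0 r0)) zc; apply: nAc.
by apply: neutrix_le Az _; rewrite zc normr_id.
Qed.

End Neutrices.

Arguments above_div {S} n {A r}.

(** * External limits *)

Section Limits.
Context {S : realFieldType}.
Implicit Types (A K M N : neutrix S) (al ga : extnum S) (r s e : S).

Lemma ext_lt_abs_sub s al e :
  ext_lt (ext_abs (ext_sub (ext_real s) al)) [set e] <->
  forall k, nset (npart al) k -> `|s - rep al| + k < e.
Proof.
rewrite /ext_abs /ext_sub /ext_real /ext_set /= max_zero_neutrix.
split=> [h k Ak|h _ _ [k Ak <-] ->]; last exact: h.
by apply: h => //; exists k.
Qed.

Lemma ext_lt_abs_half s al e : above (npart al) e ->
  `|s - rep al| < e / 2 -> ext_lt (ext_abs (ext_sub (ext_real s) al)) [set e].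
Proof.
move=> he hs; apply/ext_lt_abs_sub => k Ak; rewrite [ltRHS]splitr.
by apply: ltrD hs _; exact: (above_div 1 he).
Qed.

Lemma ext_lt_abs_rep s al e :
  ext_lt (ext_abs (ext_sub (ext_real s) al)) [set e] -> `|s - rep al| < e.
Proof.
by move=> /ext_lt_abs_sub /(_ 0 (neutrix0 _)); rewrite addr0.
Qed.

Lemma outer_limitP X (h : S -> S) a M al :
  outer_limit X (fun x => ext_real (h x)) a M al <->
  forall e, above (npart al) e -> exists2 d, above M d &
    forall x, X x -> above M `|x - a| -> `|x - a| < d -> `|h x - rep al| < e.
Proof.
split=> H e he.
  have [d Md hd] := H _ he; exists d => // x Xx xM xd.
  by apply: ext_lt_abs_rep; exact: hd.
have [d Md hd] := H _ (above_div 1 he); exists d => // x Xx xM xd.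
by apply: ext_lt_abs_half => //; exact: hd.
Qed.

Lemma inner_limit2P X (h : S * S -> S) c M N al :
  inner_limit2 X (fun p => ext_real (h p)) c M N al <->
  forall e, above (npart al) e -> exists d1 d2, [/\ above M d1, above N d2 &
    forall p, X p -> 0 < `|p.1 - c.1| < d1 -> 0 < `|p.2 - c.2| < d2 ->
      `|h p - rep al| < e].
Proof.
split=> H e he.
  have [d1 [d2 [Md Nd hd]]] := H _ he; exists d1, d2; split=> // p Xp p1 p2.
  by apply: ext_lt_abs_rep; exact: hd.
have [d1 [d2 [Md Nd hd]]] := H _ (above_div 1 he).
exists d1, d2; split=> // p Xp p1 p2.
by apply: ext_lt_abs_half => //; exact: hd.
Qed.

(** The intersection of all the limits is itself a limit: if [e] is above the
    neutrix of the intersection [ga], then [rep ga + e/2] is excluded by some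
    limit [al], whose neutrix is then below [e/2] and which contains [rep ga];
    so closeness to [al] within [e/2] gives closeness to [ga] within [e]. *)
Lemma is_ext_lim_attained (L : extnum S -> Prop) (P : S -> S -> Prop) ga :
  (forall al, L al <-> forall e, above (npart al) e -> P (rep al) e) ->
  (forall l l' e e', P l e -> `|l - l'| <= e' -> P l' (e + e')) ->
  is_ext_lim L ga -> L ga.
Proof.
move=> LP Pshift [_ gaE]; apply/LP => e he.
have he2 := above_div 1 he.
have ga_e2 : ~ ext_set ga (rep ga + e / 2).
  rewrite ext_setP addrAC subrr add0r; by case/aboveP: he2.
have ga_rep : lim_set L (rep ga).
  by rewrite -gaE ext_setP subrr; exact: neutrix0.
have [al [Lal nal]] : exists al, L al /\ ~ ext_set al (rep ga + e / 2).
  apply: contrapT => H; apply: ga_e2; rewrite gaE => al Lal.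
  by apply: contrapT => nal; apply: H; exists al.
have Kal : nset (npart al) (rep ga - rep al) by apply/ext_setP/ga_rep.
have al_e2 : above (npart al) (e / 2).
  apply/aboveP; split; first exact: above_gt0 he2.
  by move=> Ke2; apply: nal; rewrite ext_setP addrAC; exact: neutrixD.
rewrite [e]splitr; apply: (Pshift (rep al)); first exact: ((LP al).1 Lal).
by rewrite distrC; apply/ltW/al_e2; last by []; exact: neutrix_norm.
Qed.

Lemma is_ext_lim_outer X (h : S -> S) a M ga :
  is_ext_lim (outer_limit X (fun x => ext_real (h x)) a M) ga ->
  outer_limit X (fun x => ext_real (h x)) a M ga.
Proof.
apply: (@is_ext_lim_attained _ (fun l e => exists2 d, above M d & forall x,
  X x -> above M `|x - a| -> `|x - a| < d -> `|h x - l| < e)).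
  exact: outer_limitP.
move=> l l' e e' [d Md hd] ll'.
exists d => // x Xx xM xd; rewrite -(subrKA l).
by apply: le_lt_trans (ler_normD _ _) _; apply: ltr_leD => //; exact: hd.
Qed.

Lemma is_ext_lim_inner2 X (h : S * S -> S) c M N ga :
  is_ext_lim (inner_limit2 X (fun p => ext_real (h p)) c M N) ga ->
  inner_limit2 X (fun p => ext_real (h p)) c M N ga.
Proof.
apply: (@is_ext_lim_attained _ (fun l e => exists d1 d2,
  [/\ above M d1, above N d2 & forall p, X p -> 0 < `|p.1 - c.1| < d1 ->
    0 < `|p.2 - c.2| < d2 -> `|h p - l| < e])).
  exact: inner_limit2P.
move=> l l' e e' [d1 [d2 [Md Nd hd]]] ll'; exists d1, d2; split=> // p Xp p1 p2.
rewrite -(subrKA l).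
by apply: le_lt_trans (ler_normD _ _) _; apply: ltr_leD => //; exact: hd.
Qed.

End Limits.

(** * Differentiability in epsilon-delta form *)

Section Slopes.
Context {S : realFieldType}.
Implicit Types (phi : S -> S) (g : S * S -> S) (c l t u v e d r : S).

Lemma dist_between t u v c r : `|u - c| < r -> `|v - c| < r ->
  u <= t <= v -> `|t - c| < r.
Proof.
rewrite !ltr_norml => /andP[? ?] /andP[? ?] /andP[? ?].
by apply/andP; split; lra.
Qed.

Lemma dist_itv c r : [set` `[c - r, c + r]] = [set x : S | `|x - c| <= r].
Proof. by apply/funext => x; rewrite /= in_itv/= ler_distl. Qed.

Definition has_slope phi t l : Prop := forall e, 0 < e -> exists2 d, 0 < d &
  forall t', `|t' - t| < d -> `|phi t' - phi t - l * (t' - t)| <= e * `|t' - t|.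

Lemma differentiable_expansion g p : differentiable g p ->
  forall e, 0 < e -> exists2 d, 0 < d &
    forall q, `|q.1 - p.1| < d -> `|q.2 - p.2| < d ->
      `|g q - g p -
        (partial_x g p * (q.1 - p.1) + partial_y g p * (q.2 - p.2))| <=
      e * (`|q.1 - p.1| + `|q.2 - p.2|).
Proof.
move=> dg e e0.
have px : partial_x g p = 'd g p (1, 0).
  rewrite -deriveE// /derive.
  rewrite [X in X @ _](_ : _ = fun h => h^-1 *: (g (h + p.1, p.2) - g p)).
    by rewrite /partial_x /derive1 -surjective_pairing.
  apply/funext => h /=; congr (_ *: (g _ - _)).
  by rewrite [LHS]surjective_pairing /= [_ *: 1]mulr1 [_ *: 0]mulr0 add0r.
have py : partial_y g p = 'd g p (0, 1).
  rewrite -deriveE// /derive.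
  rewrite [X in X @ _](_ : _ = fun h => h^-1 *: (g (p.1, h + p.2) - g p)).
    by rewrite /partial_y /derive1 -surjective_pairing.
  apply/funext => h /=; congr (_ *: (g _ - _)).
  by rewrite [LHS]surjective_pairing /= [_ *: 1]mulr1 [_ *: 0]mulr0 add0r.
have /eqaddoP /(_ _ e0) := diff_locally dg.
move=> /nbhs_ballP[d /= d0 hd]; exists d => // -[x y] /= xd yd.
have /hd : ball (0 : S * S) d (x - p.1, y - p.2).
  by split; rewrite /= -ball_normE /= sub0r normrN.
have -> : (g \o shift p - (cst (g p) + 'd g p)) (x - p.1, y - p.2) =
    g (x, y) - g p - (partial_x g p * (x - p.1) + partial_y g p * (y - p.2)).
  rewrite -[LHS]/(g ((x - p.1, y - p.2) + p) -
    (g p + 'd g p (x - p.1, y - p.2))) px py [in LHS]opprD [in LHS]addrA.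
  have -> : (x - p.1, y - p.2) + p = (x, y).
    by rewrite [LHS]surjective_pairing /= !subrK.
  congr (_ - _).
  have -> : (x - p.1, y - p.2) = (x - p.1) *: (1, 0) + (y - p.2) *: (0, 1) :> S * S.
    rewrite [RHS]surjective_pairing /= ![_ *: 1]mulr1 ![_ *: 0]mulr0.
    by rewrite addr0 add0r.
  by rewrite linearD !linearZ /= ![_ *: _]mulrC.
move=> /le_trans; apply; apply: ler_wpM2l; first exact: ltW.
by rewrite /= prod_normE /= ge_max lerDl lerDr !normr_ge0.
Qed.

Lemma differentiable_slope_x g x y : differentiable g (x, y) ->
  has_slope (fun x' => g (x', y)) x (partial_x g (x, y)).
Proof.
move=> dg e /(differentiable_expansion dg)[d d0 hd]; exists d => // x' xd.
by have := hd (x', y) xd; rewrite /= subrr normr0 mulr0 !addr0; apply.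
Qed.

Lemma differentiable_slope_y g x y : differentiable g (x, y) ->
  has_slope (fun y' => g (x, y')) y (partial_y g (x, y)).
Proof.
move=> dg e /(differentiable_expansion dg)[d d0 hd]; exists d => // y' yd.
by have := hd (x, y'); rewrite /= subrr normr0 mulr0 !add0r; apply.
Qed.

Lemma has_slope_continuous phi t l : has_slope phi t l ->
  forall e, 0 < e -> exists2 d, 0 < d &
    forall t', `|t' - t| < d -> `|phi t' - phi t| < e.
Proof.
move=> hl e e0; have [d d0 hd] := hl 1 ltr01.
have c0 : 0 < `|l| + 1 by rewrite ltr_wpDl.
exists (Num.min d (e / (`|l| + 1))); first by rewrite lt_min d0 divr_gt0.
move=> t'; rewrite lt_min ltr_pdivlMr// => /andP[/hd h1 h2].
apply: le_lt_trans h2; rewrite mulrDr mulr1 [X in _ <= X + _]mulrC -normrM.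
rewrite -lerBlDl; apply: le_trans (lerB_dist _ _) _.
by rewrite -[leRHS]mul1r.
Qed.

Lemma has_slope_affine phi t l p q r : has_slope phi t l ->
  has_slope (fun t => p * phi t + q * t + r) t (p * l + q).
Proof.
move=> hl e e0; have c0 : 0 < `|p| + 1 by rewrite ltr_wpDl.
have [d d0 hd] := hl (e / (`|p| + 1)) (divr_gt0 e0 c0).
exists d => // t' /hd h.
have -> : p * phi t' + q * t' + r - (p * phi t + q * t + r) -
    (p * l + q) * (t' - t) = p * (phi t' - phi t - l * (t' - t)) by ring.
rewrite normrM; apply: le_trans (ler_wpM2l (normr_ge0 p) h) _.
rewrite mulrA ler_wpM2r// mulrCA ler_piMr ?ltW//.
by rewrite ltr_pdivrMr// mul1r ltrDl.
Qed.

(** Over a field that is not complete, such an [s] need not exist. *)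
Definition is_sublevel_sup phi u v s : Prop :=
  [/\ u <= s <= v,
      forall t, u <= t <= v -> phi t <= 0 -> t <= s &
      forall w, w < s -> exists t, [/\ u <= t <= v, w < t & phi t <= 0]].

(** Intermediate values: at the last point where [phi <= 0], continuity rules
    out both [phi < 0] and [phi > 0]. *)
Lemma sublevel_sup_root phi u v s : is_sublevel_sup phi u v s ->
  (forall t, u <= t <= v -> exists l, has_slope phi t l) -> 0 < phi v ->
  phi s = 0 /\ forall t, s < t <= v -> 0 < phi t.
Proof.
case=> suv ub lub hphi phiv; have [us sv] := andP suv.
have cont e : 0 < e -> exists2 d, 0 < d &
    forall t', `|t' - s| < d -> `|phi t' - phi s| < e.
  by move=> e0; have [l /has_slope_continuous] := hphi s suv; exact.
have pos t : s < t <= v -> 0 < phi t.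
  move=> /andP[st tv]; rewrite ltNge; apply/negP => /ub.
  by rewrite tv (le_trans us (ltW st)) => /(_ isT); rewrite leNgt st.
split=> //; apply/eqP; rewrite eq_le; apply/andP; split; rewrite leNgt; apply/negP.
  move=> phis; have [d d0 hd] := cont _ phis.
  have sd : s - d < s by rewrite ltrBlDr ltrDl.
  have [t [tuv dt phit]] := lub _ sd; have ts := ub _ tuv phit.
  have /hd : `|t - s| < d by rewrite distrC ger0_norm ?subr_ge0// ltrBlDr -ltrBlDl.
  rewrite distrC ltr_norml => /andP[_]; rewrite ltrBlDl ltrDr.
  by rewrite ltNge phit.
rewrite -oppr_gt0 => phis; have [d d0 hd] := cont _ phis.
have sltv : s < v.
  rewrite lt_neqAle sv andbT; apply/eqP => sv'; move: phiv; rewrite -sv'; lra.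
pose t := Num.min v (s + d / 2).
have st : s < t by rewrite lt_min sltv ltrDl divr_gt0.
have tv : t <= v by rewrite ge_min lexx.
have /hd : `|t - s| < d.
  rewrite ger0_norm ?subr_ge0 ?ltW// ltrBlDl; apply: le_lt_trans (_ : s + d / 2 < _).
    by rewrite ge_min lexx orbT.
  by rewrite ltrD2l; lra.
rewrite ltr_norml => /andP[_]; rewrite ltrBlDl subrr.
by rewrite ltNge ltW// pos// st.
Qed.

(** Affine perturbations are included because the mean value inequality looks
    for a zero of [phi] minus an affine function. *)
Definition sublevel_complete phi u v : Prop := forall p q r,
  let psi t := p * phi t + q * t + r in
  psi u <= 0 -> exists s, is_sublevel_sup psi u v s.

(** Mean value inequality.  If it failed, subtracting from [phi] an affine
    function of slope slightly above [m] would give a function that is negative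
    at [u] and positive at [v]; at its last zero the slope would have to be
    nonnegative. *)
Lemma mean_value_le phi (D : S -> S) m u v : u <= v ->
  sublevel_complete phi u v ->
  (forall t, u <= t <= v -> has_slope phi t (D t)) ->
  (forall t, u < t < v -> D t <= m) ->
  phi v - phi u <= m * (v - u).
Proof.
move=> uv cphi hD Dm; rewrite leNgt; apply/negP => lt_m.
have ltuv : u < v.
  rewrite lt_neqAle uv andbT; apply/eqP => uv'; move: lt_m.
  by rewrite uv' !subrr mulr0 ltxx.
pose k := phi v - phi u - m * (v - u).
have k0 : 0 < k by rewrite subr_gt0.
pose c := k / (2 * (v - u)).
have vu0 : 0 < v - u by rewrite subr_gt0.
have c0 : 0 < c by rewrite divr_gt0// mulr_gt0.
have cE : c * (v - u) = k / 2 by rewrite /c; field; rewrite gt_eqF.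
pose r := (m + c) * u - phi u - k / 4.
pose psi t := 1 * phi t + (- (m + c)) * t + r.
have slope t : u <= t <= v -> has_slope psi t (1 * D t + - (m + c)).
  by move=> /hD; exact: has_slope_affine.
have psiu : psi u = - (k / 4) by rewrite /psi /r; ring.
have psiv : psi v = k / 4.
  have -> : psi v = k + m * (v - u) - (m * (v - u) + c * (v - u)) - k / 4.
    by rewrite /psi /r /k; ring.
  by rewrite cE; field.
have [|s sup_s] := cphi 1 (- (m + c)) r; first by rewrite -/(psi u) psiu; lra.
have [suv _ _] := sup_s; have [us sv] := andP suv.
have [|/= psis pos] := sublevel_sup_root sup_s
    (fun t tuv => ex_intro _ _ (slope t tuv)).
  by rewrite -/(psi v) psiv; lra.
rewrite -/(psi s) in psis.
have ltus : u < s.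
  by rewrite lt_neqAle us andbT; apply/eqP => us'; move: psis; rewrite -us' psiu; lra.
have ltsv : s < v.
  by rewrite lt_neqAle sv andbT; apply/eqP => sv'; move: psis; rewrite sv' psiv; lra.
have [d d0 hd] := slope s suv _ (divr_gt0 c0 (ltr0Sn _ 1)).
pose h := Num.min (v - s) (d / 2).
have h0 : 0 < h by rewrite lt_min subr_gt0 ltsv divr_gt0.
have hv : s + h <= v by rewrite -lerBrDl ge_min lexx.
have psih : 0 < psi (s + h) by apply: pos; rewrite ltrDl h0.
have hd' : h < d by apply: (@le_lt_trans _ _ (d / 2)); [rewrite ge_min lexx orbT|lra].
have := hd (s + h); rewrite addrAC subrr add0r gtr0_norm// => /(_ hd').
rewrite psis subr0 => /ler_normlP[_] /=.
have := Dm s; rewrite ltus ltsv => /(_ isT) Ds.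
have : D s * h <= m * h by rewrite ler_pM2r.
have : 0 < c * h by rewrite mulr_gt0.
move: psih; lra.
Qed.

Lemma mean_value_dist phi (D : S -> S) l e u v : u <= v ->
  sublevel_complete phi u v ->
  (forall t, u <= t <= v -> has_slope phi t (D t)) ->
  (forall t, u < t < v -> `|D t - l| <= e) ->
  `|phi v - phi u - l * (v - u)| <= e * (v - u).
Proof.
move=> uv cphi hD De; rewrite ler_norml; apply/andP; split.
  pose nphi t := -1 * phi t + 0 * t + 0.
  have : nphi v - nphi u <= (e - l) * (v - u).
    apply: (@mean_value_le nphi (fun t => -1 * D t + 0)) => //.
    - move=> p q r psi psiu.
      have psiE : psi = fun t => - p * phi t + q * t + r.
        by apply/funext => t; rewrite /psi /nphi; ring.
      by rewrite psiE in psiu *; exact: cphi.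
    - by move=> t /hD; exact: has_slope_affine.
    - by move=> t /De; rewrite ler_norml => /andP[]; lra.
  by rewrite /nphi; lra.
have : phi v - phi u <= (l + e) * (v - u).
  apply: (@mean_value_le phi D) => // t /De.
  by rewrite ler_norml => /andP[]; lra.
by lra.
Qed.

(** One exceptional point [b] is harmless: split the interval there. *)
Lemma mean_value_punctured phi (D : S -> S) l e b u v :
  (forall u' v', u <= u' -> v' <= v -> u' <= v' -> sublevel_complete phi u' v') ->
  (forall t, u <= t <= v -> has_slope phi t (D t)) ->
  (forall t, u <= t <= v -> t != b -> `|D t - l| <= e) ->
  u <= v -> `|phi v - phi u - l * (v - u)| <= e * (v - u).
Proof.
move=> cphi hD De uv.
have half u' v' : u <= u' -> v' <= v -> u' <= v' -> ~~ (u' < b < v') ->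
    `|phi v' - phi u' - l * (v' - u')| <= e * (v' - u').
  move=> uu vv uv' nb; apply: (@mean_value_dist _ D) => //; first exact: cphi.
    by move=> t /andP[h1 h2]; apply: hD; rewrite (le_trans uu h1) (le_trans h2).
  move=> t /andP[h1 h2]; apply: De.
    by rewrite (le_trans uu (ltW h1)) (le_trans (ltW h2)).
  by apply: contraNneq nb => <-; rewrite h1 h2.
have [/andP[ub bv]|] := boolP (u < b < v); last exact: half.
have -> : phi v - phi u - l * (v - u) =
    (phi v - phi b - l * (v - b)) + (phi b - phi u - l * (b - u)) by ring.
have -> : e * (v - u) = e * (v - b) + e * (b - u) by ring.
apply: le_trans (ler_normD _ _) _; apply: lerD.
  by apply: half => //; [exact: ltW|exact: ltW|rewrite ltxx].
by apply: half => //; [exact: ltW|exact: ltW|rewrite ltxx andbF].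
Qed.

(** Derivative bounds on a punctured box, where the cross [x = a] or [y = b] is
    removed, bound the difference quotients on the whole box: on a vertical
    line [x <> a] there is one exceptional point, and the line [x = a] is a
    limit of such lines. *)
Lemma punctured_box_quotient (h : S -> S -> S) (D : S -> S -> S) l e a b d1 d2 :
  (forall x u v, `|x - a| < d1 -> u <= v -> `|u - b| < d2 -> `|v - b| < d2 ->
    sublevel_complete (h x) u v) ->
  (forall x y, `|x - a| < d1 -> `|y - b| < d2 -> has_slope (h x) y (D x y)) ->
  (forall y, `|y - b| < d2 -> exists l, has_slope (h ^~ y) a l) ->
  (forall x y, 0 < `|x - a| < d1 -> 0 < `|y - b| < d2 -> `|D x y - l| <= e) ->
  forall x y y', `|x - a| < d1 -> `|y - b| < d2 -> `|y' - b| < d2 ->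
    `|h x y - h x y' - l * (y - y')| <= e * `|y - y'|.
Proof.
move=> ch hD hcont De x y y' xd yd y'd.
wlog yy' : y y' yd y'd / y' <= y => [wl|].
  have [/wl|/ltW/wl] := leP y' y; first exact.
  move=> /(_ y'd yd); rewrite [`|y' - y|]distrC.
  have -> : h x y' - h x y - l * (y' - y) = - (h x y - h x y' - l * (y - y')) by ring.
  by rewrite normrN.
have conv t : y' <= t <= y -> `|t - b| < d2 by exact: dist_between.
have off x' : 0 < `|x' - a| < d1 ->
    `|h x' y - h x' y' - l * (y - y')| <= e * (y - y').
  move=> x'a; have /andP[_ x'd] := x'a.
  apply: (@mean_value_punctured _ (D x') l e b) => //.
  - move=> u v y'u vy uv; apply: ch => //; apply: conv.
      by rewrite y'u (le_trans uv).
    by rewrite vy (le_trans y'u).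
  - by move=> t /conv; exact: hD.
  - move=> t /conv tb tneb; apply: De => //.
    by rewrite tb andbT normr_gt0 subr_eq0.
rewrite [`|y - y'|]ger0_norm ?subr_ge0//.
have [xa|xa] := eqVneq x a; last by apply: off; rewrite normr_gt0 subr_eq0 xa.
rewrite {}xa in xd *; apply/ler_addgt0Pr => k k0.
have k2 : 0 < k / 2 by rewrite divr_gt0.
have d10 : 0 < d1 by rewrite -(normr0 S) -(subrr a).
have [l1 /has_slope_continuous/(_ _ k2)[r1 r10 hr1]] := hcont y yd.
have [l2 /has_slope_continuous/(_ _ k2)[r2 r20 hr2]] := hcont y' y'd.
pose r := Num.min (d1 / 2) (Num.min (r1 / 2) (r2 / 2)).
have r0 : 0 < r by rewrite !lt_min !divr_gt0.
have half_lt (z : S) : 0 < z -> r <= z / 2 -> `|a + r - a| < z.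
  by move=> z0 rz; rewrite addrAC subrr add0r gtr0_norm//; lra.
have /off o : 0 < `|a + r - a| < d1.
  rewrite half_lt// ?ge_min ?lexx// addrAC subrr add0r gtr0_norm// r0.
  by [].
have /hr1 {}hr1 := half_lt _ r10 ltac:(by rewrite !ge_min lexx orbT).
have /hr2 {}hr2 := half_lt _ r20 ltac:(by rewrite !ge_min lexx !orbT).
rewrite -[_ - _ - _](subrK (h (a + r) y - h (a + r) y' - l * (y - y'))) addrC.
apply: le_trans (ler_normD _ _) _; apply: lerD => //.
have -> : h a y - h a y' - l * (y - y') -
    (h (a + r) y - h (a + r) y' - l * (y - y')) =
    (h (a + r) y' - h a y') - (h (a + r) y - h a y) by ring.
apply: le_trans (ler_normB _ _) _; rewrite [k]splitr; apply: lerD; exact: ltW.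
Qed.

End Slopes.


(** * Internal functions of one variable *)

Section Internal.
Context {R : realType} {I : Type} {F : set_system I} {UF : UltraFilter F}.
Local Notation S := (hyper R UF).
Implicit Types (x y u v : S) (phi : S -> S).

Lemma hyper_le x y : x <= y <-> F [set i | repr x i <= repr y i].
Proof. by rewrite -{1}[x]hreprK -{1}[y]hreprK; split=> /hleP. Qed.

Lemma hyper_lt x y : x < y <-> F [set i | repr x i < repr y i].
Proof.
split=> [xy|h].
  have [//|h] := in_ultra_setVsetC [set i | repr x i < repr y i] UF.
  suff : y <= x by rewrite leNgt xy.
  by apply/hyper_le; apply: filterS h => i /= /negP; rewrite -leNgt.
rewrite ltNge; apply/negP => /hyper_le h'.
by have [i /= [h1 h2]] := filter_ex (filterI h h'); rewrite ltNge h2 in h1.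
Qed.

Lemma internal_fun1_affine (U : set S) phi p q r : internal_fun1 U phi ->
  internal_fun1 U (fun t => p * phi t + q * t + r).
Proof.
case=> G hG.
exists (fun i t => repr p i * G i t + repr q i * t + repr r i) => t /hG ->.
rewrite -{1}[p]hreprK -{1}[q]hreprK -{1}[r]hreprK -{2}[t]hreprK.
by rewrite ![_ * _]hmulE [X in X + _]haddE [LHS]haddE.
Qed.

Definition sublevel_sup (G : I -> R -> R) u v : I -> R := fun i =>
  sup [set t | repr u i <= t <= repr v i /\ G i t <= 0].

(** Completeness for internal sets: nonempty bounded subsets of an ultrapower
    need not have a least upper bound, but internal ones do, namely the class
    of the componentwise least upper bounds. *)
Lemma sublevel_supP (G : I -> R -> R) phi u v : u <= v ->
  (forall t, u <= t <= v -> phi t = hcls UF (fun i => G i (repr t i))) ->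
  phi u <= 0 ->
  is_sublevel_sup phi u v (hcls UF (sublevel_sup G u v)).
Proof.
move=> uv hG phiu; set s := hcls _ _.
pose E i := [set t | repr u i <= t <= repr v i /\ G i t <= 0].
have sE : F [set i | repr s i = sup (E i)] by exact: repr_hcls.
have phi_le t : u <= t <= v -> phi t <= 0 <-> F [set i | G i (repr t i) <= 0].
  move=> /hG ->; split=> [/hleP//|h]; exact/hleP.
have bdE i : has_ubound (E i) by exists (repr v i) => t [/andP[]].
have ub t : u <= t <= v -> phi t <= 0 -> t <= s.
  move=> tuv /(phi_le _ tuv) ht; case/andP: tuv => /hyper_le ut /hyper_le tv.
  apply/hyper_le; apply: filterS2 sE (filterI (filterI ut tv) ht) => i /= -> [[a b] c].
  by apply: ub_le_sup => //; split=> //; exact/andP.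
have uuv : u <= u <= v by rewrite lexx.
have neE : F [set i | E i !=set0].
  move/(phi_le _ uuv): phiu => phiu; move/hyper_le: uv => uv'.
  apply: filterS2 uv' phiu => i /= a b; exists (repr u i).
  by split=> //; rewrite lexx.
have sv : s <= v.
  apply/hyper_le; apply: filterS2 sE neE => i /= -> ne.
  by apply: ge_sup => // t [/andP[]].
split=> //; first by rewrite (ub _ uuv phiu).
move=> w /hyper_lt ws.
have ex : F [set i | exists t, E i t /\ repr w i < t].
  apply: filterS3 sE neE ws => i /= -> ne ws.
  by have [t Et wt] := sup_gt ne ws; exists t.
pose T i := xget 0 [set t | E i t /\ repr w i < t].
have TE : F [set i | E i (repr (hcls UF T) i) /\ repr w i < repr (hcls UF T) i].
  apply: filterS2 ex (repr_hcls UF T) => i /= [t ht] ->.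
  exact: (@xgetPex _ 0 [set t | E i t /\ repr w i < t] (ex_intro _ t ht)).
have tuv : u <= hcls UF T <= v.
  by apply/andP; split; apply/hyper_le; apply: filterS TE => i /= [[/andP[]]].
exists (hcls UF T); split=> //; first by apply/hyper_lt; apply: filterS TE => i /= [].
by apply/(phi_le _ tuv); apply: filterS TE => i /= [[]].
Qed.

Lemma internal_sublevel_complete phi u v : u <= v ->
  internal_fun1 [set t | u <= t <= v] phi -> sublevel_complete phi u v.
Proof.
move=> uv iphi p q r psi psiu.
have [G hG] : internal_fun1 [set t | u <= t <= v] psi by exact: internal_fun1_affine.
by exists (hcls UF (sublevel_sup G u v)); exact: sublevel_supP.
Qed.

End Internal.

(** * Zeros of a function with controlled difference quotients *)

Section Zeros.
Context {S : realFieldType}.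
Implicit Types (g : S * S -> S) (a b c d e w x y z : S).

Lemma half_dist_ge t c u : `|t - c * u| <= `|c| / 2 * `|u| ->
  `|c| / 2 * `|u| <= `|t|.
Proof.
move=> h; have := le_trans (lerB_dist (c * u) t) (_ : _ <= `|c| / 2 * `|u|).
by rewrite distrC normrM => /(_ h); lra.
Qed.

Lemma linear_relation_bound cx cy ex ey w z : cy != 0 -> ey <= `|cy| / 2 ->
  `|cx * w + cy * z| <= ex * `|w| + ey * `|z| ->
  `|z| <= 2 * (`|cx| + ex) / `|cy| * `|w|.
Proof.
rewrite -normr_gt0 => c0 eyc h; rewrite mulrAC ler_pdivlMr//.
have h1 : `|cy * z| <= `|cx * w + cy * z| + `|cx * w|.
  rewrite -[X in `|X| <= _](addrK (cx * w)) [cy * z + _]addrC.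
  exact: ler_normB.
have h2 : ey * `|z| <= `|cy| / 2 * `|z| by rewrite ler_wpM2r.
by move: h1; rewrite !normrM; lra.
Qed.

Lemma linear_relation_ratio cx cy ex ey w z : cy != 0 -> w != 0 ->
  0 <= ex -> 0 <= ey -> ey <= `|cy| / 2 ->
  `|cx * w + cy * z| <= ex * `|w| + ey * `|z| ->
  `|z / w + cx / cy| <= 2 * (ex / `|cy|) + 2 * (ey * `|cx| / `|cy| ^+ 2).
Proof.
move=> c0 w0 ex0 ey0 eyc h; have hz := linear_relation_bound c0 eyc h.
have nc : 0 < `|cy| by rewrite normr_gt0.
have nw : 0 < `|w| by rewrite normr_gt0.
have -> : z / w + cx / cy = (cx * w + cy * z) / (w * cy).
  by field; rewrite c0 w0.
rewrite normrM normfV normrM ler_pdivrMr ?mulr_gt0//.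
have -> : (2 * (ex / `|cy|) + 2 * (ey * `|cx| / `|cy| ^+ 2)) * (`|w| * `|cy|) =
    2 * ex * `|w| + ey * (2 * `|cx| / `|cy| * `|w|).
  by field; rewrite gt_eqF.
apply: le_trans h _.
have h1 : ey * `|z| <= ey * (2 * (`|cx| + ex) / `|cy| * `|w|) by rewrite ler_wpM2l.
have h2 : ey * (2 * ex / `|cy| * `|w|) <= ex * `|w|.
  have -> : ey * (2 * ex / `|cy| * `|w|) = ey / (`|cy| / 2) * (ex * `|w|).
    by field; rewrite gt_eqF.
  by rewrite ler_piMl ?mulr_ge0// ler_pdivrMr ?mul1r// divr_gt0.
have h3 : ey * (2 * (`|cx| + ex) / `|cy| * `|w|) =
    ey * (2 * `|cx| / `|cy| * `|w|) + ey * (2 * ex / `|cy| * `|w|) by ring.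
by move: h1; rewrite h3; lra.
Qed.

Definition x_quotient g a b d1 d2 l e : Prop := forall x x' y,
  `|x - a| < d1 -> `|x' - a| < d1 -> `|y - b| < d2 ->
  `|g (x, y) - g (x', y) - l * (x - x')| <= e * `|x - x'|.

Definition y_quotient g a b d1 d2 l e : Prop := forall x y y',
  `|x - a| < d1 -> `|y - b| < d2 -> `|y' - b| < d2 ->
  `|g (x, y) - g (x, y') - l * (y - y')| <= e * `|y - y'|.

Lemma zeros_linear_relation g a b d1 d2 cx cy ex ey x x' y y' :
  x_quotient g a b d1 d2 cx ex -> y_quotient g a b d1 d2 cy ey ->
  `|x - a| < d1 -> `|x' - a| < d1 -> `|y - b| < d2 -> `|y' - b| < d2 ->
  g (x, y) = 0 -> g (x', y') = 0 ->
  `|cx * (x - x') + cy * (y - y')| <= ex * `|x - x'| + ey * `|y - y'|.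
Proof.
move=> Qx Qy xd x'd yd y'd g0 g0'.
have -> : cx * (x - x') + cy * (y - y') =
    - ((g (x, y') - g (x', y') - cx * (x - x')) +
       (g (x, y) - g (x, y') - cy * (y - y'))) by rewrite g0 g0'; ring.
rewrite normrN; apply: le_trans (ler_normD _ _) _.
by apply: lerD; [exact: Qx|exact: Qy].
Qed.

Section SlopeInY.
Context (g : S * S -> S) (a b d1 d2 cy : S).
Hypotheses (cy0 : cy != 0) (Qy : y_quotient g a b d1 d2 cy (`|cy| / 2)).

Lemma y_quotient_ge x y y' : `|x - a| < d1 -> `|y - b| < d2 -> `|y' - b| < d2 ->
  `|cy| / 2 * `|y - y'| <= `|g (x, y) - g (x, y')|.
Proof. by move=> xd yd y'd; apply: half_dist_ge; exact: Qy. Qed.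

Lemma zero_unique x y y' : `|x - a| < d1 -> `|y - b| < d2 -> `|y' - b| < d2 ->
  g (x, y) = 0 -> g (x, y') = 0 -> y = y'.
Proof.
move=> xd yd y'd g0 g0'; have := y_quotient_ge xd yd y'd.
rewrite g0 g0' subrr normr0 pmulr_rle0 ?divr_gt0 ?normr_gt0//.
by rewrite normr_le0 subr_eq0 => /eqP.
Qed.

Lemma zero_near eta x y : `|x - a| < d1 -> `|y - b| < d2 -> 0 < d2 ->
  `|g (x, b)| <= `|cy| * eta / 4 -> g (x, y) = 0 -> `|y - b| <= eta / 2.
Proof.
move=> xd yd d20 gxb g0; have bd : `|b - b| < d2 by rewrite subrr normr0.
have := y_quotient_ge xd yd bd; rewrite g0 sub0r normrN => h.
have c0 : 0 < `|cy| by rewrite normr_gt0.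
by rewrite -(ler_pM2l c0); lra.
Qed.

(** Multiplying by [cy] makes [g (x, _)] increasing whatever the sign of [cy]. *)
Lemma sign_change eta x : `|x - a| < d1 -> 0 < eta < d2 ->
  `|g (x, b)| <= `|cy| * eta / 4 ->
  cy * g (x, b - eta) < 0 /\ 0 < cy * g (x, b + eta).
Proof.
move=> xd /andP[eta0 etad] gxb.
have c0 : 0 < `|cy| by rewrite normr_gt0.
have bd : `|b - b| < d2 by rewrite subrr normr0 (lt_trans eta0).
have cc : cy * cy = `|cy| * `|cy| by rewrite -!expr2 -normrX ger0_norm ?sqr_ge0.
have dev t : `|t| = eta ->
    `|cy * g (x, b + t) - cy * cy * t| <= 3 / 4 * (`|cy| * `|cy| * eta).
  move=> tE; have td : `|b + t - b| < d2 by rewrite addrAC subrr add0r tE.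
  have := Qy xd td bd; rewrite [b + t - b]addrAC subrr add0r tE => h.
  have -> : cy * g (x, b + t) - cy * cy * t =
      cy * (g (x, b + t) - g (x, b) - cy * t + g (x, b)) by ring.
  rewrite normrM.
  have -> : 3 / 4 * (`|cy| * `|cy| * eta) =
      `|cy| * (`|cy| / 2 * eta + `|cy| * eta / 4) by field.
  by rewrite ler_pM2l//; apply: le_trans (ler_normD _ _) _; exact: lerD.
have pos : 0 < `|cy| * `|cy| * eta by rewrite !mulr_gt0.
have := dev (- eta); rewrite normrN gtr0_norm// => /(_ erefl).
have := dev eta; rewrite gtr0_norm// => /(_ erefl).
rewrite !ler_norml cc => /andP[h1 h2] /andP[h3 h4].
by split; lra.
Qed.

Lemma slope_y_neq0 x y l : `|x - a| < d1 -> `|y - b| < d2 ->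
  has_slope (fun y => g (x, y)) y l -> l != 0.
Proof.
move=> xd yd hl; apply/eqP => l0.
have c0 : 0 < `|cy| by rewrite normr_gt0.
have [d d0] := hl _ (divr_gt0 c0 (ltr0Sn S 3)).
rewrite {}l0; pose t := Num.min (d / 2) ((d2 - `|y - b|) / 2).
have t0 : 0 < t by rewrite lt_min !divr_gt0// subr_gt0.
have td : t <= d / 2 by rewrite ge_min lexx.
have td2 : t <= (d2 - `|y - b|) / 2 by rewrite ge_min lexx orbT.
move=> /(_ (y + t)); rewrite [y + t - y]addrAC subrr add0r.
rewrite [`|t|]gtr0_norm// mul0r subr0 => h.
have ytd : `|y + t - b| < d2.
  rewrite addrAC; apply: le_lt_trans (ler_normD _ _) _.
  by rewrite [`|t|]gtr0_norm//; lra.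
have := y_quotient_ge xd ytd yd; rewrite [y + t - y]addrAC subrr add0r.
rewrite [`|t|]gtr0_norm// => h'.
have td' : t < d by lra.
have : 0 < `|cy| * t by rewrite mulr_gt0.
by have := h td'; lra.
Qed.

Context (cx ex : S).
Hypotheses (ex0 : 0 <= ex) (Qx : x_quotient g a b d1 d2 cx ex).

Lemma zeros_lipschitz x x' y y' :
  `|x - a| < d1 -> `|x' - a| < d1 -> `|y - b| < d2 -> `|y' - b| < d2 ->
  g (x, y) = 0 -> g (x', y') = 0 ->
  `|y - y'| <= 2 * (`|cx| + ex) / `|cy| * `|x - x'|.
Proof.
move=> xd x'd yd y'd g0 g0'.
apply: (linear_relation_bound cy0 (lexx _)).
exact: (zeros_linear_relation Qx Qy).
Qed.

(** Differentiability of the implicit function in the ordinary sense: the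
    Lipschitz bound turns the remainder of [g] into [o(|x - c|)]. *)
Lemma zeros_slope f (U : set S) c : (forall x, U x -> `|x - a| < d1) ->
  (forall x, U x -> `|f x - b| < d2) -> (forall x, U x -> g (x, f x) = 0) ->
  U c -> differentiable g (c, f c) ->
  forall e, 0 < e -> exists2 d, 0 < d & forall x, U x -> 0 < `|x - c| < d ->
    `|(f x - f c) / (x - c)
      + partial_x g (c, f c) / partial_y g (c, f c)| < e.
Proof.
move=> Ua Ub Ug Uc dg e e0; set lx := partial_x _ _; set ly := partial_y _ _.
have ly0 : ly != 0.
  exact: slope_y_neq0 (Ua _ Uc) (Ub _ Uc) (differentiable_slope_y dg).
have nly : 0 < `|ly| by rewrite normr_gt0.
pose L := 2 * (`|cx| + ex) / `|cy|.
have L0 : 0 <= L by rewrite divr_ge0// mulr_ge0// addr_ge0.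
have L1 : 0 < 2 * (1 + L) by rewrite mulr_gt0// ltr_pwDl.
pose k := e * `|ly| / (2 * (1 + L)).
have k0 : 0 < k by rewrite divr_gt0// mulr_gt0.
have [d d0 hd] := differentiable_expansion dg k0.
exists (d / (1 + L)); first by rewrite divr_gt0// ltr_pwDl.
move=> x Ux /andP[w0 wd].
have hz : `|f x - f c| <= L * `|x - c|.
  by apply: zeros_lipschitz; rewrite ?Ug//; [exact: Ua|exact: Ua|exact: Ub|exact: Ub].
rewrite ltr_pdivlMr ?ltr_pwDl// in wd.
have Lw : 0 <= L * `|x - c| by rewrite mulr_ge0.
have := hd (x, f x); rewrite /= Ug// Ug// subrr sub0r normrN -/lx -/ly => h.
have {h} := h ltac:(lra) ltac:(lra).
set w := x - c; set z := f x - f c => h.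
have wn0 : w != 0 by rewrite -normr_gt0.
have -> : z / w + lx / ly = (lx * w + ly * z) / (w * ly).
  by field; rewrite ly0 wn0.
rewrite normrM normfV normrM ltr_pdivrMr ?mulr_gt0//.
apply: le_lt_trans h _.
have le1 : k * (`|w| + `|z|) <= k * ((1 + L) * `|w|).
  by rewrite ler_pM2l// mulrDl mul1r lerD2l.
apply: le_lt_trans le1 _.
have -> : k * ((1 + L) * `|w|) = e * (`|w| * `|ly|) / 2.
  by rewrite /k; field; rewrite gt_eqF// ltr_pwDl.
have : 0 < e * (`|w| * `|ly|) by rewrite !mulr_gt0.
by lra.
Qed.

End SlopeInY.

End Zeros.

(** * External estimates for the implicit function *)

Section External.
Context {S : realFieldType}.
Implicit Types (A K M N : neutrix S) (al ga : extnum S) (U : set S)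
  (V : set (S * S)) (g : S * S -> S) (f : S -> S) (a b c d e l x y : S).

(** The difference quotients of [g (a, _)] at [b] are comparable both with
    [cy] and with [rep beta], so [cy] is as large as [rep beta]. *)
Lemma partial_N_y_rep V g N beta a b d cy : above N d ->
  (forall y, `|y - b| < d -> V (a, y)) ->
  (forall y, `|y - b| < d ->
    `|g (a, y) - g (a, b) - cy * (y - b)| <= `|cy| / 2 * `|y - b|) ->
  partial_N_y N V g (a, b) beta -> zeroless beta -> ~ nset (npart beta) cy.
Proof.
move=> Nd Vd Qd /outer_limitP lim /zeroless_rep/above_norm nbeta Acy.
have [d' Nd' hd] := lim _ (above_div 1 nbeta).
pose t := Num.min d d' / 2.
have Nt : above N t by exact: (above_div 1 (above_min Nd Nd')).
have t0 := above_gt0 Nt.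
have md : Num.min d d' <= d by rewrite ge_min lexx.
have md' : Num.min d d' <= d' by rewrite ge_min lexx orbT.
have td : t < d by rewrite /t in t0 *; lra.
have td' : t < d' by rewrite /t in t0 *; lra.
have btE : b + t - b = t by rewrite addrAC subrr add0r.
have Vt : V (a, b + t) by apply: Vd; rewrite btE gtr0_norm.
have := hd (b + t) Vt; rewrite /= btE [`|t|]gtr0_norm// => /(_ Nt td') h1.
have := Qd (b + t); rewrite btE [`|t|]gtr0_norm// => /(_ td) h2.
set q := g (a, b + t) - g (a, b) in h1 h2.
have q_le : `|q / t| <= 3 / 2 * `|cy|.
  rewrite normrM normfV [`|t|]gtr0_norm// ler_pdivrMr//.
  have := lerB_dist q (cy * t); rewrite normrM [`|t|]gtr0_norm//; lra.
have := lerB_dist (rep beta) (q / t); rewrite distrC => h3.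
suff : nset (npart beta) (rep beta) by case/aboveP: nbeta => _ nb /neutrix_norm.
apply: (neutrix_le (neutrixMn 3 Acy)).
rewrite normrMn -[leRHS]mulr_natl.
by lra.
Qed.

(** Stability turns [eta > N] into [|cy| eta > A], so that [A]-continuity of
    [g] controls [g (x, b)] at the scale needed for a zero in
    [[b - eta, b + eta]]. *)
Lemma small_on_axis V g M N A a b d1 d2 cy :
  stable_for N A -> ~ nset A cy -> above M d1 -> above N d2 ->
  (forall x y, `|x - a| < d1 -> `|y - b| < d2 -> V (x, y)) ->
  y_quotient g a b d1 d2 cy (`|cy| / 2) -> g (a, b) = 0 ->
  inner_continuous2 M N A V (fun p => ext_real (g p)) (a, b) ->
  forall eta, above N eta -> exists2 delta, above M delta &
    forall x, `|x - a| < delta -> `|g (x, b)| <= `|cy| * eta / 4.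
Proof.
move=> st nAc Md1 Nd2 Vd Qy g0 cont eta Neta.
have eta0 := above_gt0 Neta; have d20 := above_gt0 Nd2.
have c0 := above_gt0 (above_norm nAc).
have [d1' [d2' [Md1' Nd2' hd]]] :=
  cont _ (above_div 7 (stable_for_above st Neta nAc)).
have d20' := above_gt0 Nd2'.
exists (Num.min d1 d1'); first exact: above_min.
move=> x; rewrite lt_min => /andP[xd1 xd1'].
have [->|xa] := eqVneq x a.
  by rewrite g0 normr0 divr_ge0// mulr_ge0// ltW.
(* The point [(x, b)] lies on the excluded cross, hence the small shift. *)
pose t := Num.min (eta / 12) (Num.min (d2 / 2) (d2' / 2)).
have t0 : 0 < t by rewrite !lt_min !divr_gt0.
have te : t <= eta / 12 by rewrite ge_min lexx.
have td2 : t <= d2 / 2 by rewrite !ge_min lexx orbT.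
have td2' : t <= d2' / 2 by rewrite !ge_min lexx !orbT.
have btE : `|b + t - b| = t by rewrite addrAC subrr add0r gtr0_norm.
have bd : `|b - b| < d2 by rewrite subrr normr0.
have btd : `|b + t - b| < d2 by rewrite btE; lra.
have /ext_lt_abs_rep : ext_lt (ext_abs (ext_sub (ext_real (g (x, b + t)))
    (ext_add (ext_real (g (a, b))) (ext_neutrix A)))) [set `|cy| * eta / 8].
  apply: (hd (x, b + t)); first exact: Vd.
    by rewrite /= xd1' andbT normr_gt0 subr_eq0.
  by rewrite /= btE t0; lra.
rewrite /= g0 add0r subr0 => h1.
have := Qy x _ _ xd1 btd bd; rewrite btE => h2.
have := lerB_dist (g (x, b + t) - g (x, b)) (cy * (b + t - b)).
rewrite [`|cy * _|]normrM btE => h3.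
have h4 : `|g (x, b)| <= `|g (x, b + t)| + `|g (x, b + t) - g (x, b)|.
  by have := lerB_dist (g (x, b)) (g (x, b + t)); rewrite distrC; lra.
have h5 : `|cy| * t <= `|cy| * (eta / 12) by rewrite ler_pM2l.
by lra.
Qed.

(** The reals bounded by a natural multiple of [L] form a proper subset because
    a nonzero neutrix forces the order to be non-archimedean. *)
Lemma exists_neutrix_containing M m L : nset M m -> m != 0 ->
  exists K : neutrix S, nset K L.
Proof.
move=> Mm m0; pose B := [set x : S | exists n : nat, `|x| <= `|L| *+ n].
have B0 : B 0 by exists 0%N; rewrite normr0.
have [|x y [n hn] yx|Bi BB] := neutrix_of_le B0.
- move=> x y [n hn] [k hk]; exists (`|x| + `|y|).
    by exists (n + k)%N; rewrite ger0_norm ?addr_ge0// mulrnDr lerD.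
  by rewrite ler_norm.
- by exists n; exact: le_trans hn.
have BT : B <> setT.
  move=> BT; apply: (@neutrix_proper _ M); apply/seteqP; split=> // z _.
  have [n hn] : B (z / m * L) by rewrite BT.
  have [L0|L0] := eqVneq L 0.
    have [k] : B 1 by rewrite BT.
    by rewrite L0 normr0 mul0rn normr1 ler10.
  apply: (neutrix_le (neutrixMn n Mm)).
  rewrite normrMn -[leRHS]mulr_natl -ler_pdivrMr ?normr_gt0//.
  by rewrite -(@ler_pM2r _ `|L|) ?normr_gt0// mulr_natl -normfV -!normrM.
by exists (Neutrix Bi B0 BB BT); exists 1%N.
Qed.

(** A nonzero neutrix [M] makes [M]-differentiability a mere boundedness
    condition: the bound spans a neutrix, which is a limit of the difference
    quotients. *)
Lemma lipschitz_D_limit M m U f L c : nset M m -> m != 0 ->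
  (forall x, U x -> `|f x - f c| <= L * `|x - c|) ->
  lim_exists (D_limit M U f c).
Proof.
move=> Mm m0 fL; have [K KL] := exists_neutrix_containing L Mm m0.
exists (ext_neutrix K); apply/outer_limitP => e /= Ke.
have [d Md] := exists_above M; exists d => // x Ux xM _.
have xc := above_gt0 xM.
apply: (@le_lt_trans _ _ L); last exact: Ke.
by rewrite subr0 normrM normfV ler_pdivrMr// fL.
Qed.

Lemma slope_D_limit M U f c l : nset M `<=` [set 0] ->
  (forall e, 0 < e -> exists2 d, 0 < d & forall x, U x -> 0 < `|x - c| < d ->
    `|(f x - f c) / (x - c) - l| < e) ->
  lim_exists (D_limit M U f c).
Proof.
move=> M0 hl; exists (ext_real l); apply/outer_limitP => e /above_gt0 /hl[d d0 hd].
exists d; first by move=> s _ /M0 -> ->.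
by move=> x Ux /above_gt0 x0 xd; apply: hd => //; rewrite x0.
Qed.

(** From [cx (x - a) + cy (f x - b) ~ 0] with error bounds [ex > Kx] and
    [ey > Ky], the quotient [(f x - b) / (x - a)] is within
    [2 ex/|cy| + 2 ey |cx|/cy^2] of [- cx/cy]; the neutrix of [gx / gy]
    contains [Kx / cy] and [cx Ky / cy^2], and thus every [e] above it leaves
    room for suitable [ex] and [ey]. *)
Lemma implicit_D_limit g M N gx gy U f a b :
  zeroless gy ->
  (forall e, above (npart gx) e -> exists d1 d2,
    [/\ above M d1, above N d2 & x_quotient g a b d1 d2 (rep gx) e]) ->
  (forall e, above (npart gy) e -> exists d1 d2,
    [/\ above M d1, above N d2 & y_quotient g a b d1 d2 (rep gy) e]) ->
  U a -> f a = b -> (forall x, U x -> g (x, f x) = 0) ->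
  (forall eta, above N eta -> exists2 delta, above M delta &
    forall x, U x -> `|x - a| < delta -> `|f x - b| < eta) ->
  D_limit M U f a (ext_opp (ext_div gx gy)).
Proof.
case: gx gy => cx Kx [cy Ky] /zeroless_rep /= nKcy Hx Hy Ua fa fg near_b.
have c0 := above_gt0 (above_norm nKcy); have cy0 : cy != 0 by rewrite -normr_gt0.
apply/outer_limitP => e /=; set T := max_neutrix _ _ => Te.
have e0 := above_gt0 Te.
have [T1 /subset_trans T2] := max_neutrixS
  (scale_neutrix cx (scale_neutrix (cy ^+ 2)^-1 Ky))
  (max_neutrix (scale_neutrix cy^-1 Kx)
    (mul_neutrix Kx (scale_neutrix (cy ^+ 2)^-1 Ky))).
have {}T2 := subset_trans (max_neutrixS (scale_neutrix cy^-1 Kx)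
    (mul_neutrix Kx (scale_neutrix (cy ^+ 2)^-1 Ky))).1 (T2 _ (@subset_refl _ _)).
have Kx_e : above Kx (e * `|cy| / 8).
  apply: (above_div 7); rewrite -[`|cy|]invrK -normfV.
  by apply: above_scale (above_sub T2 Te); rewrite invr_eq0.
have [ey [Ky_ey ey_le ey_cx]] : exists ey, [/\ above Ky ey, ey <= `|cy| / 2 &
    ey * `|cx| / `|cy| ^+ 2 <= e / 8].
  have Ky_c := above_div 1 (above_norm nKcy).
  have [->|cx0] := eqVneq cx 0.
    by exists (`|cy| / 2); split=> //; rewrite normr0 mulr0 mul0r divr_ge0// ltW.
  exists (Num.min (`|cy| / 2) (e / `|cx| / `|(cy ^+ 2)^-1| / 8)); split.
  - apply: above_min => //; apply: (above_div 7).
    apply: above_scale; first by rewrite invr_eq0 expf_eq0.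
    by apply: above_scale (above_sub T1 Te).
  - by rewrite ge_min lexx.
  - have ncx : 0 < `|cx| by rewrite normr_gt0.
    rewrite ler_pdivrMr ?exprn_gt0// -ler_pdivlMr// ge_min; apply/orP; right.
    rewrite normfV normrX invrK le_eqVlt; apply/orP; left; apply/eqP.
    by field; rewrite gt_eqF.
have [d1 [d2 [Md1 Nd2 Qx]]] := Hx _ Kx_e.
have [d1' [d2' [Md1' Nd2' Qy]]] := Hy _ Ky_ey.
have [delta Mdelta hdelta] := near_b _ (above_min Nd2 Nd2').
exists (Num.min delta (Num.min d1 d1')); first by do 2?apply: above_min.
move=> x Ux xM; rewrite !lt_min => /and3P[xdelta xd1 xd1'].
have := hdelta x Ux xdelta; rewrite lt_min => /andP[fd2 fd2'].
have w0 : x - a != 0 by rewrite -normr_gt0; exact: above_gt0 xM.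
have d10 := above_gt0 Md1; have d20 := above_gt0 Nd2.
have d10' := above_gt0 Md1'; have d20' := above_gt0 Nd2'.
have Qx' : x_quotient g a b (Num.min d1 d1') (Num.min d2 d2') cx (e * `|cy| / 8).
  move=> u u' y; rewrite !lt_min => /andP[? _] /andP[? _] /andP[? _]; exact: Qx.
have Qy' : y_quotient g a b (Num.min d1 d1') (Num.min d2 d2') cy ey.
  move=> u y y'; rewrite !lt_min => /andP[_ ?] /andP[_ ?] /andP[_ ?]; exact: Qy.
have := @zeros_linear_relation _ _ _ _ _ _ _ _ _ _ x a (f x) (f a) Qx' Qy'.
rewrite fa !subrr normr0 !lt_min xd1 xd1' fd2 fd2' d10 d10' d20 d20' fg//.
rewrite -{1}fa fg// => /(_ isT isT isT isT erefl erefl).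
move=> /(linear_relation_ratio cy0 w0 (ltW (above_gt0 Kx_e))
           (ltW (above_gt0 Ky_ey)) ey_le).
rewrite opprK => /le_lt_trans; apply.
have -> : e * `|cy| / 8 / `|cy| = e / 8 by field; rewrite gt_eqF.
by lra.
Qed.

Lemma near_inner_continuous M N U f a :
  (forall eta, above N eta -> exists2 delta, above M delta &
    forall x, U x -> `|x - a| < delta -> `|f x - f a| < eta) ->
  inner_continuous M N U (fun x => ext_real (f x)) a.
Proof.
move=> near_a e Ne; have [d Md hd] := near_a _ (above_div 1 Ne).
exists d => // x Ux /andP[_ xd]; apply: ext_lt_abs_half.
  by rewrite /= max_zero_neutrix.
by rewrite /= addr0; exact: hd.
Qed.

End External.

(** * The implicit function theorem over an ordered field *)

Section Core.
Context {S : realFieldType}.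
Context (a b r1 r2 : S) (M N : neutrix S) (V : set (S * S)) (g : S * S -> S).
Hypotheses (Mr1 : above M r1) (Nr2 : above N r2)
  (Vbox : forall x y, `|x - a| < r1 -> `|y - b| < r2 -> V (x, y))
  (dg : differentiable_on V g).
(** Completeness of [S] enters only through the restrictions of [g] to the
    horizontal and vertical segments of the box. *)
Hypotheses
  (gx_complete : forall y u v, `|y - b| < r2 -> u <= v ->
    `|u - a| < r1 -> `|v - a| < r1 -> sublevel_complete (fun x => g (x, y)) u v)
  (gy_complete : forall x u v, `|x - a| < r1 -> u <= v ->
    `|u - b| < r2 -> `|v - b| < r2 -> sublevel_complete (fun y => g (x, y)) u v).

Lemma limit_x_quotient ga :
  inner_limit2 V (fun p => ext_real (partial_x g p)) (a, b) M N ga ->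
  forall e, above (npart ga) e -> exists d1 d2,
    [/\ above M d1, above N d2 & x_quotient g a b d1 d2 (rep ga) e].
Proof.
move=> /inner_limit2P lim e /lim[d1 [d2 [Md1 Nd2 hd]]].
exists (Num.min r1 d1), (Num.min r2 d2); split; [exact: above_min..|].
have box x y : `|x - a| < Num.min r1 d1 -> `|y - b| < Num.min r2 d2 -> V (x, y).
  by rewrite !lt_min => /andP[? _] /andP[? _]; exact: Vbox.
have b_in : `|b - b| < Num.min r2 d2.
  by rewrite subrr normr0 lt_min (above_gt0 Nr2) (above_gt0 Nd2).
move=> x x' y xd x'd yd.
apply: (@punctured_box_quotient _ (fun y x => g (x, y))
  (fun y x => partial_x g (x, y)) (rep ga) e b a) yd xd x'd.
- move=> t u v; rewrite !lt_min => /andP[t1 _] uv /andP[u1 _] /andP[v1 _].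
  exact: gx_complete.
- by move=> t s td sd; apply/differentiable_slope_x/dg/box.
- move=> s sd; exists (partial_y g (s, b)).
  by apply: (differentiable_slope_y (dg _)); exact: box.
- move=> t s; rewrite !lt_min => /andP[t0 /andP[t1 t2]] /andP[s0 /andP[s1 s2]].
  by apply: ltW; apply: (hd (s, t)); [exact: Vbox|rewrite s0|rewrite t0].
Qed.

Lemma limit_y_quotient ga :
  inner_limit2 V (fun p => ext_real (partial_y g p)) (a, b) M N ga ->
  forall e, above (npart ga) e -> exists d1 d2,
    [/\ above M d1, above N d2 & y_quotient g a b d1 d2 (rep ga) e].
Proof.
move=> /inner_limit2P lim e /lim[d1 [d2 [Md1 Nd2 hd]]].
exists (Num.min r1 d1), (Num.min r2 d2); split; [exact: above_min..|].
have box x y : `|x - a| < Num.min r1 d1 -> `|y - b| < Num.min r2 d2 -> V (x, y).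
  by rewrite !lt_min => /andP[? _] /andP[? _]; exact: Vbox.
have a_in : `|a - a| < Num.min r1 d1.
  by rewrite subrr normr0 lt_min (above_gt0 Mr1) (above_gt0 Md1).
apply: (@punctured_box_quotient _ (fun x y => g (x, y))
  (fun x y => partial_y g (x, y)) (rep ga) e a b).
- move=> t u v; rewrite !lt_min => /andP[t1 _] uv /andP[u1 _] /andP[v1 _].
  exact: gy_complete.
- by move=> t s td sd; apply/differentiable_slope_y/dg/box.
- move=> s sd; exists (partial_x g (a, s)).
  by apply: (differentiable_slope_x (dg _)); exact: box.
- move=> t s; rewrite !lt_min => /andP[t0 /andP[t1 t2]] /andP[s0 /andP[s1 s2]].
  by apply: ltW; apply: (hd (t, s)); [exact: Vbox|rewrite t0|rewrite s0].
Qed.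

(** The part of the theorem that does not refer to internal objects: once the
    box is chosen, the sign change reduces the existence of the zeros to
    completeness, and all properties of the implicit function follow from its
    graph consisting of zeros of [g] in the box. *)
Lemma implicit_function_core (gx gy beta : extnum S) :
  g (a, b) = 0 ->
  inner_limit2 V (fun p => ext_real (partial_x g p)) (a, b) M N gx ->
  inner_limit2 V (fun p => ext_real (partial_y g p)) (a, b) M N gy ->
  partial_N_y N V g (a, b) beta -> zeroless beta ->
  stable_for N (npart beta) ->
  inner_continuous2 M N (npart beta) V (fun p => ext_real (g p)) (a, b) ->
  zeroless gy ->
  exists delta eta,
    [/\ above M delta, above N eta, delta < r1, eta < r2 &
    (forall x, `|x - a| <= delta ->
      rep gy * g (x, b - eta) < 0 /\ 0 < rep gy * g (x, b + eta)) /\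
    let U : set S := [set x | `|x - a| <= delta] in
    let Y : set S := [set y | `|y - b| <= eta] in
    (forall x y y', U x -> Y y -> Y y' -> g (x, y) = 0 -> g (x, y') = 0 ->
      y = y') /\
    forall f, (forall x, U x -> Y (f x)) -> (forall x, U x -> g (x, f x) = 0) ->
      [/\ f a = b, M_differentiable M U f,
          D_limit M U f a (ext_opp (ext_div gx gy)) &
          inner_continuous M N U (fun x => ext_real (f x)) a]].
Proof.
move=> g0 limx limy limN zbeta st cont zgy.
have Hx := limit_x_quotient limx; have Hy := limit_y_quotient limy.
have /zeroless_rep nKcy := zgy; set cy := rep gy in nKcy *.
have cy0 : cy != 0 by rewrite -normr_gt0; exact: above_gt0 (above_norm nKcy).
have [ex Kex] := exists_above (npart gx).
have [e1 [e2 [Me1 Ne2 Qx]]] := Hx _ Kex.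
have [k1 [k2 [Mk1 Nk2 Qy]]] := Hy _ (above_div 1 (above_norm nKcy)).
pose d1 := Num.min r1 (Num.min e1 k1); pose d2 := Num.min r2 (Num.min e2 k2).
have Md1 : above M d1 by do 2!apply: above_min => //.
have Nd2 : above N d2 by do 2!apply: above_min => //.
have d1E x : `|x - a| < d1 -> [/\ `|x - a| < r1, `|x - a| < e1 & `|x - a| < k1].
  by rewrite !lt_min => /and3P.
have d2E y : `|y - b| < d2 -> [/\ `|y - b| < r2, `|y - b| < e2 & `|y - b| < k2].
  by rewrite !lt_min => /and3P.
have {}Qx : x_quotient g a b d1 d2 (rep gx) ex.
  by move=> x x' y /d1E[_ ? _] /d1E[_ ? _] /d2E[_ ? _]; exact: Qx.
have {}Qy : y_quotient g a b d1 d2 cy (`|cy| / 2).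
  by move=> x y y' /d1E[_ _ ?] /d2E[_ _ ?] /d2E[_ _ ?]; exact: Qy.
have box x y : `|x - a| < d1 -> `|y - b| < d2 -> V (x, y).
  by move=> /d1E[? _ _] /d2E[? _ _]; exact: Vbox.
have d10 := above_gt0 Md1; have d20 := above_gt0 Nd2.
have aa : `|a - a| < d1 by rewrite subrr normr0.
have bb : `|b - b| < d2 by rewrite subrr normr0.
have nAcy : ~ nset (npart beta) cy.
  apply: (partial_N_y_rep Nd2) limN zbeta => y yd; first exact: box.
  by apply: Qy.
have small := small_on_axis st nAcy Md1 Nd2 box Qy g0 cont.
pose eta := d2 / 2; have Neta : above N eta := above_div 1 Nd2.
have eta0 := above_gt0 Neta.
have etad : eta < d2 by rewrite /eta in eta0 *; lra.
have [d Md hd] := small _ Neta.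
pose m := Num.min d1 d; pose delta := m / 2.
have Mdelta : above M delta by exact: (above_div 1 (above_min Md1 Md)).
have [deltad1 deltad] : delta < d1 /\ delta < d.
  have := above_gt0 Mdelta; have : m <= d1 by rewrite ge_min lexx.
  have : m <= d by rewrite ge_min lexx orbT.
  by rewrite /delta; split; lra.
exists delta, eta; split=> //.
- by apply: lt_le_trans deltad1 _; rewrite ge_min lexx.
- by apply: lt_le_trans etad _; rewrite ge_min lexx.
split=> [x xdelta|U Y].
  apply: (sign_change cy0 Qy); first exact: le_lt_trans deltad1.
    by rewrite eta0.
  by apply: hd; exact: le_lt_trans deltad.
have Ua x : U x -> `|x - a| < d1 by move=> /le_lt_trans; apply.
have Yb y : Y y -> `|y - b| < d2 by move=> /le_lt_trans; apply.
split=> [x y y' /Ua xd /Yb yd /Yb y'd|f fY fg].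
  exact: (zero_unique cy0 Qy).
have aU : U a by rewrite /U /= subrr normr0 (ltW (above_gt0 Mdelta)).
have fa : f a = b.
  by apply: (zero_unique cy0 Qy aa) => //; [exact/Yb/fY|exact: fg].
have near_b e : above N e -> exists2 delta, above M delta &
    forall x, U x -> `|x - a| < delta -> `|f x - b| < e.
  move=> Ne; have [d' Md' hd'] := small _ Ne; exists d' => // x Ux /hd' gxb.
  have := zero_near cy0 Qy (Ua _ Ux) (Yb _ (fY _ Ux)) d20 gxb (fg _ Ux).
  by have := above_gt0 Ne; lra.
split=> //.
- move=> c Uc; have [[m' [Mm' m'0]]|noM] := pselect (exists m, nset M m /\ m != 0).
    apply: (lipschitz_D_limit Mm' m'0) => x Ux.
    by apply: (zeros_lipschitz cy0 Qy Qx); first [exact: Ua|exact: fg|exact/Yb/fY].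
  have M0 : nset M `<=` [set 0].
    by move=> z Mz; apply/eqP/negPn/negP => z0; apply: noM; exists z.
  apply: (@slope_D_limit _ _ _ _ _
    (- (partial_x g (c, f c) / partial_y g (c, f c))) M0) => e e0.
  have dgc : differentiable g (c, f c).
    by apply: dg; apply: box; [exact: Ua|exact/Yb/fY].
  have [d' d'0 hd'] := zeros_slope cy0 Qy (ltW (above_gt0 Kex)) Qx Ua
    (fun x Ux => Yb _ (fY x Ux)) fg Uc dgc e0.
  by exists d' => // x Ux /hd' h; rewrite opprK; exact: h.
- exact: implicit_D_limit Hx Hy _ _ _ _.
- by apply: near_inner_continuous; rewrite fa.
Qed.

End Core.

(** * The ultrapower *)

Theorem theorem8p1 (R : realType) (I : Type) (F : set_system I)
    (UF : UltraFilter F)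
    (a b : hyper R UF) (M N : neutrix (hyper R UF))
    (V : set (hyper R UF * hyper R UF))
    (g : hyper R UF * hyper R UF -> hyper R UF)
    (gamma_x gamma_y beta : extnum (hyper R UF)) :
  MN_neighborhood M N (a, b) V ->
  internal_fun2 V g ->
  differentiable_on V g ->
  g (a, b) = 0 ->
  is_ext_lim
    (inner_limit2 V (fun p => ext_real (partial_x g p)) (a, b) M N) gamma_x ->
  is_ext_lim
    (inner_limit2 V (fun p => ext_real (partial_y g p)) (a, b) M N) gamma_y ->
  is_ext_lim (partial_N_y N V g (a, b)) beta ->
  zeroless beta ->
  stable_for N (npart beta) ->
  (forall p, V p ->
    inner_continuous2 M N (npart beta) V (fun q => ext_real (g q)) p /\
    inner_continuous2 M N (npart beta) V
      (fun q => ext_real (partial_y g q)) p) ->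
  zeroless gamma_y ->
  exists delta eta : hyper R UF,
    let U : set (hyper R UF) := [set` `[a - delta, a + delta]] in
    let Y : set (hyper R UF) := [set` `[b - eta, b + eta]] in
    [/\ ext_lt M [set delta], ext_lt N [set eta], U `*` Y `<=` V &
    exists f : hyper R UF -> hyper R UF,
      [/\ internal_fun1 U f,
          implicit_solution M g a b U Y f,
          forall h, implicit_solution M g a b U Y h ->
            forall x, U x -> h x = f x,
          D_set M U f a `<=` ext_opp (ext_div gamma_x gamma_y) &
          zeroless gamma_x ->
          ext_mul (ext_div gamma_x gamma_y) (ext_neutrix M) `<=` N ->
          inner_continuous M N U (fun x => ext_real (f x)) a]].
Proof.
move=> [_ [r1 [r2 [Mr1 Nr2 boxV]]]] [G hG] dg g0 limx limy limN zbeta st cont zgy.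
have Vbox (x y : hyper R UF) : `|x - a| < r1 -> `|y - b| < r2 -> V (x, y).
  move=> xr yr; apply: boxV; split; rewrite /= in_itv/= -ltr_distl//.
have Vab : V (a, b).
  by apply: Vbox; rewrite subrr normr0; [exact: above_gt0 Mr1|exact: above_gt0 Nr2].
have gx_complete (y u v : hyper R UF) : `|y - b| < r2 -> u <= v ->
    `|u - a| < r1 -> `|v - a| < r1 -> sublevel_complete (fun x => g (x, y)) u v.
  move=> yb uv ua va; apply: internal_sublevel_complete => //.
  exists (fun i t => G i (t, repr y i)) => t tuv; apply: (hG (t, y)).
  by apply: Vbox => //; exact: dist_between tuv.
have gy_complete (x u v : hyper R UF) : `|x - a| < r1 -> u <= v ->
    `|u - b| < r2 -> `|v - b| < r2 -> sublevel_complete (fun y => g (x, y)) u v.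
  move=> xa uv ub vb; apply: internal_sublevel_complete => //.
  exists (fun i t => G i (repr x i, t)) => t tuv; apply: (hG (x, t)).
  by apply: Vbox => //; exact: dist_between tuv.
have [delta [eta [Mdelta Neta deltar etar [sign_g [uniq_zero sol]]]]] :=
  implicit_function_core Mr1 Nr2 Vbox dg gx_complete gy_complete g0
    (is_ext_lim_inner2 limx) (is_ext_lim_inner2 limy) (is_ext_lim_outer limN)
    zbeta st (cont _ Vab).1 zgy.
exists delta, eta; rewrite !dist_itv.
have UYV (x y : hyper R UF) : `|x - a| <= delta -> `|y - b| <= eta -> V (x, y).
  move=> xd ye; apply: Vbox; [exact: le_lt_trans deltar|exact: le_lt_trans etar].
split=> //; first by move=> [x y] [xd yb]; exact: UYV.
pose cy := rep gamma_y.
pose H (x : hyper R UF) i t := repr cy i * G i (repr x i, t).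
(* The last zero of the increasing function [cy * g (x, _)], computed
   componentwise so that [f] is internal. *)
pose f (x : hyper R UF) := hcls UF (sublevel_sup (H x) (b - eta) (b + eta)).
have root (x : hyper R UF) : `|x - a| <= delta -> `|f x - b| <= eta /\ g (x, f x) = 0.
  move=> xd; have [neg pos] := sign_g _ xd; rewrite ler_distl.
  have bb : b - eta <= b + eta.
    rewrite lerD2l; apply: (@le_trans _ _ 0); rewrite ?oppr_le0;
    exact: ltW (above_gt0 Neta).
  have hH (t : hyper R UF) : b - eta <= t <= b + eta ->
      cy * g (x, t) = hcls UF (fun i => H x i (repr t i)).
    rewrite -ler_distl => tb; rewrite (hG (x, t) (UYV _ _ xd tb)) /=.
    by rewrite -{1}[cy]hreprK [LHS]hmulE.
  have sup_f := sublevel_supP bb hH (ltW neg).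
  have [fb _ _] := sup_f; split=> //.
  have slope (t : hyper R UF) : b - eta <= t <= b + eta ->
      exists l, has_slope (fun t => cy * g (x, t)) t l.
    rewrite -ler_distl => tb; exists (cy * partial_y g (x, t) + 0).
    have -> : (fun t => cy * g (x, t)) = (fun t => cy * g (x, t) + 0 * t + 0).
      by apply/funext => s; rewrite mul0r !addr0.
    by apply: has_slope_affine; exact/differentiable_slope_y/dg/UYV.
  have [/eqP + _] := sublevel_sup_root sup_f slope pos.
  rewrite mulf_eq0 => /orP[/eqP cy0|/eqP//].
  by have /zeroless_rep := zgy; rewrite -/cy cy0 => /(_ (neutrix0 _)).
have [fa fM fD fcont] := sol f (fun x Ux => (root x Ux).1) (fun x Ux => (root x Ux).2).
exists f; split.
- by exists (fun i s => sup [set t | repr (b - eta) i <= t <= repr (b + eta) i /\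
    repr cy i * G i (s, t) <= 0]).
- by split=> // x /root[].
- move=> h [_ hY hg _] x Ux; apply: (uniq_zero x) => //; first exact: hY.
  + by case: (root _ Ux).
  + exact: hg.
  + by case: (root _ Ux).
- by move=> s /(_ _ fD).
- by [].
Qed.
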